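(* Let $B$ be a locally 1-connected space and let $p\colon E\to B$ be a locally homotopy trivial fibration with semilocally 1-connected typical fibre $F$. Then $\Pi_1^{vert}(p)$ is a 2-bundle over $B$ with typical fibre $\Pi_1(F)$.
   Context: $I=[0,1]$. ''Basic open neighbourhoods'' are members of a chosen basis of the topology. A space is locally 1-connected if it has an open neighbourhood basis of 1-connected (path-connected and simply connected) sets; for such a base space, the basic open sets are taken to be 1-connected. A space $F$ is semilocally 1-connected if it has an open neighbourhood basis of path-connected sets $V$ whose inclusion induces the trivial map $\pi_1(V)\to\pi_1(F)$. A locally homotopy trivial fibration is a fibration $p\colon E\to B$ for which there are an open cover $\{U_i\to B\}$ and a space $F$ (the typical fibre) with fibre homotopy equivalences between $E|_{U_i}$ and $U_i\times F$ for each $i$. A fibre homotopy equivalence between spaces $Y_1,Y_2$ over a base is a pair of maps $f\colon Y_1\to Y_2$, $g\colon Y_2\to Y_1$ over the base such that $f\circ g$ and $g\circ f$ are homotopic over the base to identity maps. Vertical fundamental groupoid $\Pi_1^{vert}(p)$ of a map $p\colon Y\to X$: the object space is $Y$. Arrows are classes $[f]$ of vertical paths $f\colon I\to Y$ (paths with $p\circ f$ constant) modulo vertical homotopy (homotopy through vertical paths) relative to $\{0,1\}$. Source and target are evaluation at $0$ and $1$, units are constant paths, inversion is path reversal, composition is concatenation. The topology on the set of arrows has as basic open neighbourhoods of $[f]$ the sets $$\langle [f],U,V_0,V_1\rangle=\{[g]\mid \exists\, h\colon I^2\to p^{-1}(U),\ h(0,-)=f,\ h(1,-)=g,\ h(t,\epsilon)\in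 V_\epsilon \text{ for all } t\in I,\ \epsilon=0,1\},$$ where $U\subset X$ is a basic open neighbourhood of $p(f(0))$ and $V_0,V_1\subset Y$ are basic open neighbourhoods of $f(0)$, $f(1)$ respectively. It has a functor to $X$, where $X$ is viewed as a topological groupoid with only identity arrows. $\Pi_1(F)$ is the usual topological fundamental groupoid, i.e. the case of the map from $F$ to a point. A functor $f\colon D\to E$ between topological groupoids (subscripts $0,1$ denote object and arrow spaces) is a weak equivalence if the canonical map $D_1\to D_0^2\times_{E_0^2}E_1$ is an isomorphism and $t\circ\mathrm{pr}_2\colon D_0\times_{E_0}E_1\to E_0$ admits local sections. Two topological groupoids are weakly equivalent if there is a span of weak equivalences between them. A 2-bundle over a space $X$ is a topological groupoid $Z$ with a functor to $X$ that is, locally over $X$, weakly equivalent to a product, i.e. there is an open cover of $X$ by sets $U$ for which $Z\times_X U$ is weakly equivalent over $U$ to $G\times U$, for some topological groupoid $G$, called the typical fibre.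
   Formalization: The formal theorem also assumes that E is locally path-connected; without this the unit map of Π_1^vert(p) is not continuous (e.g. B = F = a point, E = the comb space), so Π_1^vert(p) is not a topological groupoid and the claim fails. *)

(* Defs.v *)
From HB Require Import structures.
From mathcomp Require Import all_boot all_order all_algebra generic_quotient.
From mathcomp Require Import all_classical all_reals topology normedtype.
From mathcomp Require Import homotopy.
From mathcomp Require Import lra.
Set Implicit Arguments.
Unset Strict Implicit.
Unset Printing Implicit Defensive.
Import Order.TTheory GRing.Theory Num.Theory.
Import numFieldNormedType.Exports.
Local Open Scope classical_set_scope.
Local Open Scope ring_scope.
Local Open Scope quotient_scope.

Record open_basis (X : topologicalType) := OpenBasis {
  basic_open : set (set X);
  basic_openP : basis basic_open }.

Section BasisTheory.
Variables (X : topologicalType) (BX : open_basis X).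

Lemma basis_open (U : set X) : basic_open BX U -> open U.
Proof. by case: (basic_openP BX) => + _; apply. Qed.

Lemma basis_nbhs (x : X) (U : set X) :
  nbhs x U -> exists V, [/\ basic_open BX V, V x & V `<=` U].
Proof.
by move=> xU; case: (basic_openP BX) => _ /(_ x _ xU) [V [BV Vx] VU]; exists V.
Qed.

End BasisTheory.

Lemma basis_opens (X : topologicalType) : basis (@open X).
Proof.
split=> // x U; rewrite /= nbhsE => -[V [oV Vx] VU]; by exists V.
Qed.

Definition opens_basis (X : topologicalType) : open_basis X :=
  OpenBasis (@basis_opens X).

Section UnitInterval.
Variable R : realType.

Definition unitI : Type := set_type (`[0, 1]%classic : set R).

HB.instance Definition _ := Topological.copy unitI (`[0, 1]%classic : set R).

Definition clamp (x : R) : R := Num.max 0 (Num.min 1 x).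

Lemma clamp_in x : x \in [set y : R | y \in `[0, 1]] -> clamp x = x.
Proof.
rewrite inE /= in_itv /= => /andP[x0 x1]; rewrite /clamp.
by rewrite min_r // max_r.
Qed.

Lemma clampP x : clamp x \in (`[0, 1]%classic : set R).
Proof.
by rewrite inE /= in_itv /= /clamp le_max lexx /= ge_max ler01 /= ge_min lexx.
Qed.

Definition clampI (x : R) : unitI := exist _ (clamp x) (clampP x).

Definition valI (t : unitI) : R := val t.

Lemma valI_ge0 t : 0 <= valI t.
Proof. by have := set_valP t; rewrite /= in_itv /= => /andP[]. Qed.

Lemma valI_le1 t : valI t <= 1.
Proof. by have := set_valP t; rewrite /= in_itv /= => /andP[]. Qed.

Lemma valI_inj : injective valI.
Proof. exact: val_inj. Qed.

Lemma valI_continuous : continuous (valI : unitI -> R).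
Proof. exact: initial_continuous. Qed.

Lemma valI_clampI x : 0 <= x <= 1 -> valI (clampI x) = x.
Proof. by move=> x01; rewrite /valI /= clamp_in // inE. Qed.

Lemma clampI_valI t : clampI (valI t) = t.
Proof. by apply/valI_inj; rewrite valI_clampI // valI_ge0 valI_le1. Qed.

Lemma clampI_continuous : continuous (clampI : R -> unitI).
Proof.
apply: (@continuous_comp_initial _ _ _ set_val) => x.
apply: (@continuous_max _ _ (fun=> 0)); first exact: cst_continuous.
by apply: (@continuous_min _ _ (fun=> 1)); first exact: cst_continuous.
Qed.

Lemma clampI_neq : clampI 0 != clampI 1.
Proof.
by apply/eqP => /(congr1 valI); rewrite !valI_clampI ?lexx ?ler01// => /eqP;
  rewrite eq_sym oner_eq0.
Qed.

HB.instance Definition _ := isBiPointed.Build unitI clampI_neq.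

Lemma valI0 : valI zero = 0.
Proof. by apply: valI_clampI; rewrite lexx ler01. Qed.

Lemma valI1 : valI one = 1.
Proof. by apply: valI_clampI; rewrite lexx ler01. Qed.

Definition rev_unitI (t : unitI) : unitI := clampI (1 - valI t).
Definition dblL (t : unitI) : unitI := clampI (2 * valI t).
Definition dblR (t : unitI) : unitI := clampI (2 * valI t - 1).

Lemma affine_continuous (a b : R) : continuous (fun x : R => a * x + b).
Proof.
move=> x; apply: (@continuousD _ R^o); last exact: cst_continuous.
by apply: (@continuousM R); [exact: cst_continuous|exact: cvg_id].
Qed.

Lemma affine_unitI_continuous (a b : R) :
  continuous (fun t : unitI => clampI (a * valI t + b)).
Proof.
move=> t.
apply: (@continuous_comp _ _ _ (fun t => a * valI t + b) clampI);
  last exact: clampI_continuous.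
apply: (@continuous_comp _ _ _ valI (fun x => a * x + b));
  [exact: valI_continuous|exact: affine_continuous].
Qed.

Lemma rev_unitI_continuous : continuous rev_unitI.
Proof.
rewrite /rev_unitI (_ : (fun _ => _) = fun t => clampI (- 1 * valI t + 1)).
  exact: affine_unitI_continuous.
by apply/funext => t; rewrite mulN1r addrC.
Qed.

Lemma dblL_continuous : continuous dblL.
Proof.
rewrite /dblL (_ : (fun _ => _) = fun t => clampI (2 * valI t + 0)).
  exact: affine_unitI_continuous.
by apply/funext => t; rewrite addr0.
Qed.

Lemma dblR_continuous : continuous dblR.
Proof. exact: affine_unitI_continuous. Qed.

Lemma rev_unitI0 : rev_unitI zero = one.
Proof. by rewrite /rev_unitI valI0 subr0. Qed.

Lemma rev_unitI1 : rev_unitI one = zero.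
Proof. by rewrite /rev_unitI valI1 subrr. Qed.

Lemma dblL0 : dblL zero = zero.
Proof. by rewrite /dblL valI0 mulr0. Qed.

Lemma dblR1 : dblR one = one.
Proof. by rewrite /dblR valI1; congr clampI; lra. Qed.

Lemma dblL_half t : valI t = 2^-1 -> dblL t = one.
Proof. by rewrite /dblL => ->; congr clampI; lra. Qed.

Lemma dblR_half t : valI t = 2^-1 -> dblR t = zero.
Proof. by rewrite /dblR => ->; congr clampI; lra. Qed.

Lemma pasting (S X : topologicalType) (c : S -> R) (a : R) (f g : S -> X) :
  continuous c -> continuous f -> continuous g ->
  (forall z, c z = a -> f z = g z) ->
  continuous (fun z => if c z <= a then f z else g z).
Proof.
move=> cc cf cg fg.
set k := fun z => _.
have cA : closed [set z | c z <= a].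
  by apply: (closed_comp (f := c) (D := [set x | x <= a])) => [? _|];
    [exact: cc|exact: closed_le].
have cB : closed [set z | a <= c z].
  by apply: (closed_comp (f := c) (D := [set x | a <= x])) => [? _|];
    [exact: cc|exact: closed_ge].
have fA : {within [set z | c z <= a], continuous k}.
  apply: (@subspace_eq_continuous _ _ _ f); last exact: continuous_subspaceT.
  by move=> z /set_mem /= za; change (f z = k z); rewrite /k za.
have gB : {within [set z | a <= c z], continuous k}.
  apply: (@subspace_eq_continuous _ _ _ g); last exact: continuous_subspaceT.
  move=> z /set_mem /= az; change (g z = k z); rewrite /k.
  case: ifPn => // za.
  by rewrite fg //; apply/eqP; rewrite eq_le za.
apply/continuous_subspace_setT.
rewrite (_ : setT = [set z | c z <= a] `|` [set z | a <= c z]).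
  exact: withinU_continuous.
apply/seteqP; split=> // z _ /=.
by case: (leP (c z) a) => [|/ltW]; [left|right].
Qed.

Definition concat (X : Type) (f g : unitI -> X) (t : unitI) : X :=
  if valI t <= 2^-1 then f (dblL t) else g (dblR t).

Lemma concat0 (X : Type) (f g : unitI -> X) : concat f g zero = f zero.
Proof. by rewrite /concat valI0 invr_ge0 ler0n dblL0. Qed.

Lemma concat1 (X : Type) (f g : unitI -> X) : concat f g one = g one.
Proof.
by rewrite /concat valI1 ifF ?dblR1 //; apply/negbTE; rewrite -ltNge; lra.
Qed.

Lemma concat_continuous (X : topologicalType) (f g : unitI -> X) :
  continuous f -> continuous g -> f one = g zero -> continuous (concat f g).
Proof.
move=> cf cg fg; apply: (@pasting _ _ valI 2^-1 (f \o dblL) (g \o dblR)).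
- exact: valI_continuous.
- move=> t; apply: continuous_comp; [exact: dblL_continuous|exact: cf].
- move=> t; apply: continuous_comp; [exact: dblR_continuous|exact: cg].
- by move=> t th /=; rewrite dblL_half // dblR_half.
Qed.

Lemma reverse_continuous (X : topologicalType) (f : unitI -> X) :
  continuous f -> continuous (f \o rev_unitI).
Proof.
by move=> cf t; apply: continuous_comp; [exact: rev_unitI_continuous|exact: cf].
Qed.

Lemma comp_continuous (S T X : topologicalType) (f : S -> T) (g : T -> X) :
  continuous f -> continuous g -> continuous (g \o f).
Proof. by move=> cf cg s; apply: continuous_comp; [exact: cf|exact: cg]. Qed.

Lemma pair_continuous (S T X : topologicalType) (f : S -> T) (g : S -> X) :
  continuous f -> continuous g -> continuous (fun s => (f s, g s)).
Proof. by move=> cf cg s; apply: cvg_pair; [exact: cf|exact: cg]. Qed.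

Lemma fst_continuous (S T : topologicalType) : continuous (@fst S T).
Proof. by move=> s; exact: cvg_fst. Qed.

Lemma snd_continuous (S T : topologicalType) : continuous (@snd S T).
Proof. by move=> s; exact: cvg_snd. Qed.

Definition homotopy (S X : topologicalType) (h : unitI * S -> X)
    (f g : S -> X) :=
  [/\ continuous h, forall s, h (zero, s) = f s & forall s, h (one, s) = g s].

Definition rel_endpoints (X : Type) (h : unitI * unitI -> X) :=
  forall t, h (t, zero) = h (zero, zero) /\ h (t, one) = h (zero, one).

Section HomotopyTheory.
Variables (S X : topologicalType).
Implicit Types (h k : unitI * S -> X) (f g : S -> X).

Definition hcst (f : S -> X) (z : unitI * S) : X := f z.2.
Definition hrev (h : unitI * S -> X) (z : unitI * S) : X :=
  h (rev_unitI z.1, z.2).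
Definition hcat (h k : unitI * S -> X) (z : unitI * S) : X :=
  concat (fun t => h (t, z.2)) (fun t => k (t, z.2)) z.1.

Lemma onfst_continuous (u : unitI -> unitI) (h : unitI * S -> X) :
  continuous u -> continuous h -> continuous (fun z => h (u z.1, z.2)).
Proof.
move=> cu ch; apply: (@comp_continuous _ _ _ (fun z => (u z.1, z.2)) h) => //.
apply: pair_continuous; last exact: snd_continuous.
by apply: (@comp_continuous _ _ _ fst u) => //; exact: fst_continuous.
Qed.

Lemma hcst_homotopy f : continuous f -> homotopy (hcst f) f f.
Proof.
move=> cf; split=> //.
by apply: (@comp_continuous _ _ _ snd f) => //; exact: snd_continuous.
Qed.

Lemma hrev_homotopy h f g : homotopy h f g -> homotopy (hrev h) g f.
Proof.
move=> [ch h0 h1]; split=> [|s|s]; last 2 first.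
- by rewrite /hrev /= rev_unitI0 h1.
- by rewrite /hrev /= rev_unitI1 h0.
by apply: onfst_continuous => //; exact: rev_unitI_continuous.
Qed.

Lemma hcat_homotopy h k f g e :
  homotopy h f g -> homotopy k g e -> homotopy (hcat h k) f e.
Proof.
move=> [ch h0 h1] [ck k0 k1]; split=> [|s|s]; last 2 first.
- by rewrite /hcat /= concat0 h0.
- by rewrite /hcat /= concat1 k1.
apply: (@pasting _ _ (fun z => valI z.1) 2^-1 (fun z => h (dblL z.1, z.2))
   (fun z => k (dblR z.1, z.2))).
- apply: (@comp_continuous _ _ _ fst valI); first exact: fst_continuous.
  exact: valI_continuous.
- by apply: onfst_continuous => //; exact: dblL_continuous.
- by apply: onfst_continuous => //; exact: dblR_continuous.
- by move=> z zh /=; rewrite dblL_half // dblR_half // h1 k0.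
Qed.

Lemma hcat_ind (P : X -> Prop) h k s :
  (forall t, P (h (t, s))) -> (forall t, P (k (t, s))) ->
  forall t, P (hcat h k (t, s)).
Proof. by move=> Ph Pk t; rewrite /hcat /concat /=; case: ifP. Qed.

End HomotopyTheory.

End UnitInterval.

Definition has_open_nbhd_basis (X : topologicalType) (P : set X -> Prop) :=
  forall (x : X) (U : set X), nbhs x U ->
    exists V, [/\ open V, V x, V `<=` U & P V].

Section Connectivity.
Variables (R : realType) (X : topologicalType).

Definition path_connected (A : set X) := forall x y, A x -> A y ->
  exists gamma : {path unitI R from x to y}, forall t, A (gamma t).

Definition path_homotopic_in (A : set X) (f g : unitI R -> X) :=
  exists h : unitI R * unitI R -> X,
    [/\ homotopy h f g, rel_endpoints h & forall z, A (h z)].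

(* The homomorphism from [pi_1 (V, x)] to [pi_1 (A, x)] induced by the
   inclusion is trivial, for every base point [x] of [V]. *)
Definition pi1_trivial_in (V A : set X) :=
  forall (x : X) (gamma : {path unitI R from x to x}),
    (forall t, V (gamma t)) -> path_homotopic_in A gamma (cst x).

Definition one_connected (A : set X) :=
  path_connected A /\ pi1_trivial_in A A.

Definition locally_path_connected := has_open_nbhd_basis path_connected.

Definition locally_1connected := has_open_nbhd_basis one_connected.

Definition semilocally_1connected :=
  has_open_nbhd_basis (fun V => path_connected V /\ pi1_trivial_in V setT).

End Connectivity.

Definition hurewicz_fibration (R : realType) (E B : topologicalType)
    (p : E -> B) :=
  continuous p /\
  forall (T : topologicalType) (h : unitI R * T -> B) (g : T -> E),
    continuous h -> continuous g -> (forall t, p (g t) = h (zero, t)) ->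
    exists k : unitI R * T -> E,
      [/\ continuous k, forall z, p (k z) = h z & forall t, k (zero, t) = g t].

Definition homotopic_over (R : realType) (S Y1 Y2 : topologicalType)
    (q2 : Y2 -> S) (f g : Y1 -> Y2) :=
  exists h : unitI R * Y1 -> Y2,
    homotopy h f g /\ forall t y, q2 (h (t, y)) = q2 (h (zero, y)).

Definition fibre_homotopy_equivalent (R : realType) (S Y1 Y2 : topologicalType)
    (q1 : Y1 -> S) (q2 : Y2 -> S) :=
  exists (f : Y1 -> Y2) (g : Y2 -> Y1),
    [/\ continuous f, continuous g, q2 \o f = q1 & q1 \o g = q2] /\
    homotopic_over R q2 (f \o g) idfun /\ homotopic_over R q1 (g \o f) idfun.

Definition locally_homotopy_trivial_fibration (R : realType)
    (E B F : topologicalType) (p : E -> B) :=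
  hurewicz_fibration R p /\
  exists C : set (set B),
    [/\ C `<=` open, \bigcup_(U in C) U = setT &
      forall U, C U ->
        fibre_homotopy_equivalent R
          (fun e : set_type (p @^-1` U) => p (val e))
          (fun z : set_type U * F => val z.1)].

Definition to_sub (T : Type) (A : set T) (x : T) (Ax : A x) : A :=
  exist _ x (mem_set Ax).


(* [comp e], for [e : tgt a = src b], is [a] followed by [b]. *)
Record groupoid_data := GroupoidData {
  ob : topologicalType;
  ar : topologicalType;
  src : ar -> ob;
  tgt : ar -> ob;
  idm : ob -> ar;
  inv : ar -> ar;
  comp : forall a b : ar, tgt a = src b -> ar }.
Arguments comp {g a b}.
Arguments src {g}.
Arguments tgt {g}.
Arguments idm {g}.
Arguments inv {g}.

Definition composable (G : groupoid_data) : set (ar G * ar G) :=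
  [set ab | tgt ab.1 = src ab.2].

Arguments composable : clear implicits.

Definition comp_map (G : groupoid_data) (x : composable G) : ar G :=
  comp (set_valP x).

Record is_topgroupoid (G : groupoid_data) : Prop := {
  src_idm : forall x : ob G, src (idm x) = x;
  tgt_idm : forall x : ob G, tgt (idm x) = x;
  src_inv : forall a : ar G, src (inv a) = tgt a;
  tgt_inv : forall a : ar G, tgt (inv a) = src a;
  src_comp : forall (a b : ar G) (e : tgt a = src b), src (comp e) = src a;
  tgt_comp : forall (a b : ar G) (e : tgt a = src b), tgt (comp e) = tgt b;
  comp1m : forall (a : ar G) (e : tgt (idm (src a)) = src a), comp e = a;
  compm1 : forall (a : ar G) (e : tgt a = src (idm (tgt a))), comp e = a;
  compVm : forall (a : ar G) (e : tgt (inv a) = src a), comp e = idm (tgt a);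
  compmV : forall (a : ar G) (e : tgt a = src (inv a)), comp e = idm (src a);
  compA : forall (a b c : ar G) (eab : tgt a = src b) (ebc : tgt b = src c)
    (eabc : tgt (comp eab) = src c) (eabc' : tgt a = src (comp ebc)),
    comp eabc = comp eabc';
  src_continuous : continuous (@src G);
  tgt_continuous : continuous (@tgt G);
  idm_continuous : continuous (@idm G);
  inv_continuous : continuous (@inv G);
  comp_continuous_map : continuous (@comp_map G) }.

Record topgroupoid := TopGroupoid {
  gdata :> groupoid_data;
  topgroupoidP : is_topgroupoid gdata }.

Record is_functor (D E : groupoid_data) (f0 : ob D -> ob E) (f1 : ar D -> ar E)
    : Prop := {
  f0_continuous : continuous f0;
  f1_continuous : continuous f1;
  f1_src : forall a, src (f1 a) = f0 (src a);
  f1_tgt : forall a, tgt (f1 a) = f0 (tgt a);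
  f1_idm : forall x, f1 (idm x) = idm (f0 x);
  f1_comp : forall (a b : ar D) (e : tgt a = src b)
    (e' : tgt (f1 a) = src (f1 b)), f1 (comp e) = comp e' }.

Record functor (D E : groupoid_data) := Functor {
  fob : ob D -> ob E;
  far : ar D -> ar E;
  functorP : is_functor fob far }.

Definition homeomorphism (S T : topologicalType) (f : S -> T) :=
  continuous f /\
  exists g : T -> S, [/\ continuous g, cancel f g & cancel g f].

Section WeakEquivalence.
Variables (D E : topgroupoid) (f : functor D E).

Definition hom_pullback : set ((ob D * ob D) * ar E) :=
  [set x | src x.2 = fob f x.1.1 /\ tgt x.2 = fob f x.1.2].

Lemma hom_pullbackP (a : ar D) : hom_pullback ((src a, tgt a), far f a).
Proof.
by split; [exact: (f1_src (functorP f))|exact: (f1_tgt (functorP f))].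
Qed.

Definition canonical_map (a : ar D) : hom_pullback :=
  to_sub (hom_pullbackP a).

Definition target_pullback : set (ob D * ar E) :=
  [set x | fob f x.1 = src x.2].

Definition tgt_pr2 (x : target_pullback) : ob E := tgt (val x).2.

End WeakEquivalence.

Definition admits_local_sections (S T : topologicalType) (q : S -> T) :=
  forall t : T, exists O : set T, [/\ open O, O t &
    exists s : O -> S, continuous s /\ forall x : O, q (s x) = val x].

Definition weak_equivalence (D E : topgroupoid) (f : functor D E) :=
  homeomorphism (canonical_map f) /\ admits_local_sections (@tgt_pr2 D E f).

Section Discrete.
Variable X : topologicalType.

Definition disc_data : groupoid_data :=
  @GroupoidData X X idfun idfun idfun idfun (fun a _ _ => a).

Lemma disc_topgroupoid : is_topgroupoid disc_data.
Proof.
split=> //; try by move=> x; exact: cvg_id.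
move=> x.
apply: (@comp_continuous _ _ _ (set_val : composable disc_data -> _) fst).
  exact: initial_continuous.
exact: fst_continuous.
Qed.

Definition disc : topgroupoid := TopGroupoid disc_topgroupoid.

End Discrete.

Lemma set_type_continuous (S T : topologicalType) (A : set T) (f : S -> A) :
  continuous (fun s => val (f s)) -> continuous f.
Proof. by move=> cf; exact: (@continuous_comp_initial _ _ _ set_val). Qed.

Lemma val_continuous (T : topologicalType) (A : set T) :
  continuous (val : A -> T).
Proof. exact: initial_continuous. Qed.

Lemma val_comp_continuous (S T : topologicalType) (A : set S) (f : S -> T) :
  continuous f -> continuous (fun a : A => f (val a)).
Proof.
by move=> cf; exact: (comp_continuous (@val_continuous S A) cf).
Qed.

Section Restriction.
Variables (X : topologicalType) (Z : topgroupoid) (q : functor Z (disc X)).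
Variable U : set X.

Let obU : set (ob Z) := fob q @^-1` U.
Let arU : set (ar Z) := far q @^-1` U.

Lemma restr_src (a : ar Z) : arU a -> obU (src a).
Proof. by rewrite /arU/obU /= -(f1_src (functorP q)). Qed.

Lemma restr_tgt (a : ar Z) : arU a -> obU (tgt a).
Proof. by rewrite /arU/obU /= -(f1_tgt (functorP q)). Qed.

Lemma restr_idm (x : ob Z) : obU x -> arU (idm x).
Proof. by rewrite /arU/obU /= (f1_idm (functorP q)). Qed.

Lemma restr_inv (a : ar Z) : arU a -> arU (inv a).
Proof.
have HZ := topgroupoidP Z; have Hq := functorP q.
rewrite /arU /=; have /= -> := f1_src Hq (inv a).
by rewrite (src_inv HZ) -(f1_tgt Hq).
Qed.

Lemma restr_comp (a b : ar Z) (e : tgt a = src b) : arU a -> arU (comp e).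
Proof.
have HZ := topgroupoidP Z; have Hq := functorP q.
rewrite /arU /=; have /= -> := f1_src Hq (comp e).
by rewrite (src_comp HZ) -(f1_src Hq).
Qed.

Definition restr_data : groupoid_data := @GroupoidData obU arU
  (fun a => to_sub (restr_src (set_valP a)))
  (fun a => to_sub (restr_tgt (set_valP a)))
  (fun x => to_sub (restr_idm (set_valP x)))
  (fun a => to_sub (restr_inv (set_valP a)))
  (fun a b e => to_sub (restr_comp (congr1 val e) (set_valP a))).

Lemma restr_topgroupoid : is_topgroupoid restr_data.
Proof.
have HZ := topgroupoidP Z.
split.
- by move=> x; apply: val_inj; exact: (src_idm HZ).
- by move=> x; apply: val_inj; exact: (tgt_idm HZ).
- by move=> x; apply: val_inj; exact: (src_inv HZ).
- by move=> x; apply: val_inj; exact: (tgt_inv HZ).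
- by move=> a b e; apply: val_inj; exact: (src_comp HZ).
- by move=> a b e; apply: val_inj; exact: (tgt_comp HZ).
- by move=> a e; apply: val_inj; exact: (comp1m HZ).
- by move=> a e; apply: val_inj; exact: (compm1 HZ).
- by move=> a e; apply: val_inj; exact: (compVm HZ).
- by move=> a e; apply: val_inj; exact: (compmV HZ).
- by move=> a b c *; apply: val_inj; exact: (compA HZ).
- apply: set_type_continuous.
  exact: (val_comp_continuous (A := arU) (src_continuous HZ)).
- apply: set_type_continuous.
  exact: (val_comp_continuous (A := arU) (tgt_continuous HZ)).
- apply: set_type_continuous.
  exact: (val_comp_continuous (A := obU) (idm_continuous HZ)).
- apply: set_type_continuous.
  exact: (val_comp_continuous (A := arU) (inv_continuous HZ)).
- apply: set_type_continuous.
  have P (x : composable restr_data) :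
    composable Z (val (val x).1, val (val x).2).
    exact: (congr1 val (set_valP x)).
  pose k (x : composable restr_data) : composable Z := to_sub (P x).
  rewrite (_ : (fun _ => _) = @comp_map Z \o k).
    apply: comp_continuous; last exact: (comp_continuous_map HZ).
    apply: set_type_continuous; apply: pair_continuous.
      exact: (val_comp_continuous (A := composable restr_data)
        (comp_continuous (@fst_continuous _ _) (@val_continuous _ arU))).
    exact: (val_comp_continuous (A := composable restr_data)
      (comp_continuous (@snd_continuous _ _) (@val_continuous _ arU))).
  apply/funext => x; rewrite /comp_map /=.
  by congr comp; exact: Prop_irrelevance.
Qed.

Definition restr : topgroupoid := TopGroupoid restr_topgroupoid.

End Restriction.

Section Product.
Variables (X : topologicalType) (G : topgroupoid) (U : set X).

Definition prod_data : groupoid_data :=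
  @GroupoidData (ob G * U)%type (ar G * U)%type
    (fun a => (src a.1, a.2)) (fun a => (tgt a.1, a.2))
    (fun x => (idm x.1, x.2)) (fun a => (inv a.1, a.2))
    (fun a b e => (comp (congr1 fst e), a.2)).

Lemma prod_topgroupoid : is_topgroupoid prod_data.
Proof.
have HG := topgroupoidP G.
have onfst (S T : topologicalType) (f : S -> T) :
    continuous f -> continuous (fun a : S * U => (f a.1, a.2)).
  move=> cf; apply: pair_continuous; last exact: snd_continuous.
  by apply: (@comp_continuous _ _ _ fst f) => //; exact: fst_continuous.
split.
- by move=> [x u] /=; rewrite (src_idm HG).
- by move=> [x u] /=; rewrite (tgt_idm HG).
- by move=> [x u] /=; rewrite (src_inv HG).
- by move=> [x u] /=; rewrite (tgt_inv HG).
- by move=> [a u] [b v] e /=; rewrite (src_comp HG).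
- move=> [a u] [b v] e /=; rewrite (tgt_comp HG).
  by case: (e) => _ ->.
- by move=> [a u] e /=; rewrite (comp1m HG).
- by move=> [a u] e /=; rewrite (compm1 HG).
- by move=> [a u] e /=; rewrite (compVm HG).
- by move=> [a u] e /=; rewrite (compmV HG).
- move=> [a u] [b v] [c w] e e' e1 e2 /=; congr pair.
  exact: (compA HG).
- by apply: onfst; exact: (src_continuous HG).
- by apply: onfst; exact: (tgt_continuous HG).
- by apply: onfst; exact: (idm_continuous HG).
- by apply: onfst; exact: (inv_continuous HG).
- have P (x : composable prod_data) : composable G ((val x).1.1, (val x).2.1).
    exact: (congr1 fst (set_valP x)).
  pose k (x : composable prod_data) : composable G := to_sub (P x).
  have c1 : continuous (fun x : composable prod_data => (val x).1).
    exact: (val_comp_continuous (A := composable prod_data)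
      (@fst_continuous _ _)).
  have c2 : continuous (fun x : composable prod_data => (val x).2).
    exact: (val_comp_continuous (A := composable prod_data)
      (@snd_continuous _ _)).
  rewrite (_ : @comp_map _ = fun x => (comp_map (k x), (val x).1.2)).
    apply: pair_continuous.
      apply: (@comp_continuous _ _ _ k (@comp_map G));
        last exact: (comp_continuous_map HG).
      apply: set_type_continuous; apply: pair_continuous.
        exact: (comp_continuous c1 (@fst_continuous _ _)).
      exact: (comp_continuous c2 (@fst_continuous _ _)).
    exact: (comp_continuous c1 (@snd_continuous _ _)).
  apply/funext => x; rewrite /comp_map /=.
  by congr (comp _, _); exact: Prop_irrelevance.
Qed.

Definition prod_groupoid : topgroupoid := TopGroupoid prod_topgroupoid.

End Product.

(* [Z] and [Z'] lie over [X] through their projections on objects and arrows;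
   the apex of the span is over [X] because the two composites agree. *)
Definition weakly_equivalent_over (X : topologicalType) (Z Z' : topgroupoid)
    (q0 : ob Z -> X) (q1 : ar Z -> X) (q0' : ob Z' -> X) (q1' : ar Z' -> X) :=
  exists (W : topgroupoid) (f : functor W Z) (f' : functor W Z'),
    [/\ weak_equivalence f, weak_equivalence f',
        forall w, q0 (fob f w) = q0' (fob f' w) &
        forall w, q1 (far f w) = q1' (far f' w)].

Definition is_2bundle (X : topologicalType) (Z : topgroupoid)
    (q : functor Z (disc X)) (G : topgroupoid) :=
  exists C : set (set X),
    [/\ C `<=` open, \bigcup_(U in C) U = setT &
      forall U, C U ->
        @weakly_equivalent_over X (restr q U) (prod_groupoid G U)
          (fun z => fob q (val z)) (fun a => far q (val a))
          (fun z => val z.2) (fun a => val a.2)].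

Section VerticalPaths.
Variables (R : realType) (Y X : topologicalType) (p : Y -> X).
Local Notation I := (unitI R).

Record vpath := VPath {
  vfun :> I -> Y;
  vpath_continuous : continuous vfun;
  vpath_vertical : forall s t, p (vfun s) = p (vfun t) }.

HB.instance Definition _ := gen_eqMixin vpath.
HB.instance Definition _ := gen_choiceMixin vpath.

Definition vhomotopic (f g : vpath) :=
  exists h : I * I -> Y,
    [/\ homotopy h f g, rel_endpoints h &
        forall t s s', p (h (t, s)) = p (h (t, s'))].

Lemma vhomotopic_refl f : vhomotopic f f.
Proof.
exists (hcst f); split=> // [|t s s']; last exact: vpath_vertical.
exact/hcst_homotopy/vpath_continuous.
Qed.

Lemma vhomotopic_sym f g : vhomotopic f g -> vhomotopic g f.
Proof.
move=> [h [hfg hr hv]]; exists (hrev h); split.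
- exact: hrev_homotopy.
- move=> t; rewrite /hrev /= rev_unitI0.
  by split; [rewrite !(hr _).1|rewrite !(hr _).2].
- by move=> t s s'; exact: hv.
Qed.

Lemma vhomotopic_trans f g k :
  vhomotopic f g -> vhomotopic g k -> vhomotopic f k.
Proof.
move=> [h [hfg hr hv]] [h' [hgk hr' hv']]; exists (hcat h h'); split.
- exact: hcat_homotopy hfg hgk.
- have [_ h0 h1] := hfg; have [_ h'0 h'1] := hgk.
  move=> t; rewrite /hcat /= !concat0 /concat; split; case: ifP => _.
  + exact: (hr _).1.
  + by rewrite (hr' _).1 h'0 -h1 (hr _).1.
  + exact: (hr _).2.
  + by rewrite (hr' _).2 h'0 -h1 (hr _).2.
- by move=> t s s'; rewrite /hcat /concat /=; case: ifP.
Qed.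

Definition vhomotopicb (f g : vpath) : bool := `[< vhomotopic f g >].

Lemma vhomotopicb_equiv : equiv_class_of vhomotopicb.
Proof.
split.
- by move=> f; apply/asboolP; exact: vhomotopic_refl.
- by move=> f g; apply/idP/idP => /asboolP fg; apply/asboolP;
    exact: vhomotopic_sym.
- move=> g f k /asboolP fg /asboolP gk; apply/asboolP.
  exact: vhomotopic_trans fg gk.
Qed.

Canonical vhomotopic_equiv := EquivRelPack vhomotopicb_equiv.

Lemma vcst_vertical (y : Y) (s t : I) : p (cst y s) = p (cst y t).
Proof. by []. Qed.

Definition vcst (y : Y) : vpath :=
  VPath (@cst_continuous I Y y) (vcst_vertical y).

Lemma vrev_vertical (f : vpath) s t :
  p ((f \o @rev_unitI R) s) = p ((f \o @rev_unitI R) t).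
Proof. exact: vpath_vertical. Qed.

Definition vrev (f : vpath) : vpath :=
  VPath (reverse_continuous (@vpath_continuous f)) (vrev_vertical f).

Lemma vconcat_vertical (f g : vpath) (e : f one = g zero) s t :
  p (concat f g s) = p (concat f g t).
Proof.
have H u : p (concat f g u) = p (f one).
  rewrite /concat; case: ifP => _; first exact: vpath_vertical.
  by rewrite e; exact: vpath_vertical.
by rewrite !H.
Qed.

Definition vconcat (f g : vpath) (e : f one = g zero) : vpath :=
  VPath (concat_continuous (@vpath_continuous f) (@vpath_continuous g) e)
        (vconcat_vertical e).

End VerticalPaths.

Section VerticalGroupoid.
Variables (R : realType) (Y X : topologicalType) (p : Y -> X).
Variables (BX : open_basis X) (BY : open_basis Y).
Local Notation I := (unitI R).
Local Notation vpath := (vpath R p).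

Definition varrow : Type := {eq_quot (vhomotopic_equiv R p)}.

HB.instance Definition _ := EqQuotient.on varrow.
HB.instance Definition _ := Choice.on varrow.

Definition vclass (f : vpath) : varrow := \pi_varrow f.

(* The set [<[f], U, V0, V1>]; the intermediate paths [h (t, -)] need not be
   vertical. *)
Definition basic_nbhd (f : vpath) (U : set X) (V0 V1 : set Y) : set varrow :=
  [set a | exists g : vpath, a = vclass g /\
    exists h : I * I -> Y,
      [/\ homotopy h f g, forall z, U (p (h z)),
          forall t, V0 (h (t, zero)) & forall t, V1 (h (t, one))]].

Definition varrow_open (O : set varrow) :=
  forall f : vpath, O (vclass f) ->
    exists U V0 V1,
      [/\ basic_open BX U /\ U (p (f zero)),
          basic_open BY V0 /\ V0 (f zero),
          basic_open BY V1 /\ V1 (f one) & basic_nbhd f U V0 V1 `<=` O].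

Lemma basic_nbhdS (f : vpath) U V0 V1 U' V0' V1' :
  U `<=` U' -> V0 `<=` V0' -> V1 `<=` V1' ->
  basic_nbhd f U V0 V1 `<=` basic_nbhd f U' V0' V1'.
Proof.
move=> UU VV0 VV1 _ [g [-> [h [hfg hU h0 h1]]]]; exists g; split=> //.
by exists h; split=> // t; [exact/UU|exact/VV0|exact/VV1].
Qed.

Lemma varrow_openT : varrow_open setT.
Proof.
move=> f _.
have [U [BU fU _]] := basis_nbhs BX (@filterT _ (nbhs (p (f zero))) _).
have [V0 [BV0 fV0 _]] := basis_nbhs BY (@filterT _ (nbhs (f zero)) _).
have [V1 [BV1 fV1 _]] := basis_nbhs BY (@filterT _ (nbhs (f one)) _).
by exists U, V0, V1; split.
Qed.

Lemma basis_refine (T : topologicalType) (BT : open_basis T) (x : T) V W :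
  basic_open BT V /\ V x -> basic_open BT W /\ W x ->
  exists S, [/\ basic_open BT S /\ S x, S `<=` V & S `<=` W].
Proof.
move=> [BV Vx] [BW Wx].
have [|S [BS Sx SVW]] := basis_nbhs BT (x := x) (U := V `&` W).
  by apply: filterI; apply: open_nbhs_nbhs; split=> //;
    [exact: basis_open BV|exact: basis_open BW].
by exists S; split=> // y /SVW[].
Qed.

Lemma varrow_openI : setI_closed varrow_open.
Proof.
move=> O O' oO oO' f [/oO[U [V0 [V1 [hU h0 h1 s]]]] /oO'[W [W0 [W1 [kW k0 k1 s']]]]].
have [S [hS SU SW]] := basis_refine hU kW.
have [S0 [hS0 SV0 SW0]] := basis_refine h0 k0.
have [S1 [hS1 SV1 SW1]] := basis_refine h1 k1.
exists S, S0, S1; split=> // a Sa; split.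
  by apply: s; apply: basic_nbhdS Sa.
by apply: s'; apply: basic_nbhdS Sa.
Qed.

Lemma varrow_open_bigU (J : Type) (O : J -> set varrow) :
  (forall j, varrow_open (O j)) -> varrow_open (\bigcup_j O j).
Proof.
move=> oO f [j _ /oO[U [V0 [V1 [hU h0 h1 s]]]]].
by exists U, V0, V1; split=> //; move=> a /s Oa; exists j.
Qed.

End VerticalGroupoid.

Section VerticalArrows.
Variables (R : realType) (Y X : topologicalType) (p : Y -> X).
Variables (BX : open_basis X) (BY : open_basis Y).

Definition varrow_space of open_basis X & open_basis Y : Type := varrow R p.

HB.instance Definition _ := Choice.on (varrow_space BX BY).
HB.instance Definition _ := isOpenTopological.Build (varrow_space BX BY)
  (varrow_openT BX BY) (@varrow_openI R Y X p BX BY)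
  (@varrow_open_bigU R Y X p BX BY).

End VerticalArrows.

Section VerticalFundamentalGroupoid.
Variables (R : realType) (Y X : topologicalType) (p : Y -> X).
Variables (BX : open_basis X) (BY : open_basis Y).

(* Defined on representatives; see [vsrc_vclass], [vtgt_vclass], [vinv_vclass]
   and [vcomp_vclass] for the independence of the choice. *)
Definition vsrc (a : varrow R p) : Y := repr a zero.
Definition vtgt (a : varrow R p) : Y := repr a one.
Definition vidm (y : Y) : varrow R p := vclass (vcst R p y).
Definition vinv (a : varrow R p) : varrow R p := vclass (vrev (repr a)).
Definition vcomp (a b : varrow R p) (e : vtgt a = vsrc b) : varrow R p :=
  vclass (vconcat e).

Definition vert_groupoid : groupoid_data :=
  @GroupoidData Y (varrow_space R p BX BY) vsrc vtgt vidm vinv vcomp.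

Definition vert_proj (a : varrow R p) : X := p (vsrc a).

End VerticalFundamentalGroupoid.

Definition fund_groupoid (R : realType) (F : topologicalType)
    (BF : open_basis F) : groupoid_data :=
  vert_groupoid R (fun _ : F => tt : discrete_topology unit)
    (opens_basis _) BF.

Section VerticalTheory.
Variables (R : realType) (Y X : topologicalType) (p : Y -> X).
Variables (BX : open_basis X) (BY : open_basis Y).
Local Notation I := (unitI R).
Implicit Types f g : vpath R p.

Lemma vclassP f g : vclass f = vclass g <-> vhomotopic f g.
Proof.
split=> [/eqmodP/asboolP//|fg]; by apply/eqmodP/asboolP.
Qed.

Lemma repr_vclass f : vhomotopic (repr (vclass f)) f.
Proof. by apply/vclassP; rewrite /vclass reprK. Qed.

Lemma vhomotopic_ends f g : vhomotopic f g -> f zero = g zero /\ f one = g one.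
Proof.
move=> [h [[_ h0 h1] hr _]].
by split; [rewrite -h0 -h1 (hr one).1|rewrite -h0 -h1 (hr one).2].
Qed.

Lemma vsrc_vclass f : vsrc (vclass f) = f zero.
Proof. exact: (vhomotopic_ends (repr_vclass f)).1. Qed.

Lemma vtgt_vclass f : vtgt (vclass f) = f one.
Proof. exact: (vhomotopic_ends (repr_vclass f)).2. Qed.

Lemma vinv_vclass f : vinv (vclass f) = vclass (vrev f).
Proof.
apply/vclassP; have [h [[ch h0 h1] hr hv]] := repr_vclass f.
exists (fun z => h (z.1, rev_unitI z.2)); split.
- split=> [|s|s]; [|exact: h0|exact: h1].
  have c : continuous (fun z : I * I => (z.1, rev_unitI z.2)).
    apply: pair_continuous; first exact: fst_continuous.
    exact: comp_continuous (@snd_continuous _ _) (@rev_unitI_continuous R).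
  exact: comp_continuous c ch.
- by move=> t /=; rewrite rev_unitI0 rev_unitI1; have [] := hr t.
- by move=> t s s'; exact: hv.
Qed.

Lemma vcomp_vclass f g (e : vtgt (vclass f) = vsrc (vclass g))
  (e' : f one = g zero) : vcomp e = vclass (vconcat e').
Proof.
apply/vclassP; have [h [hf hr hv]] := repr_vclass f.
have [k [kg kr kv]] := repr_vclass g.
have [ch h0 h1] := hf; have [ck k0 k1] := kg.
have hk t : h (t, one) = k (t, zero).
  by rewrite (hr t).2 (kr t).1 h0 k0.
pose H (z : I * I) := concat (fun s => h (z.1, s)) (fun s => k (z.1, s)) z.2.
have onsnd (u : I -> I) (l : I * I -> Y) : continuous u -> continuous l ->
    continuous (fun z => l (z.1, u z.2)).
  move=> cu cl; have c : continuous (fun z : I * I => (z.1, u z.2)).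
    apply: pair_continuous; first exact: fst_continuous.
    exact: comp_continuous (@snd_continuous _ _) cu.
  exact: comp_continuous c cl.
exists H; split.
- split=> [|s|s].
  + apply: (@pasting _ _ _ (fun z => valI z.2) 2^-1
      (fun z => h (z.1, dblL z.2)) (fun z => k (z.1, dblR z.2))).
    * exact: comp_continuous (@snd_continuous _ _) (@valI_continuous R).
    * by apply: onsnd => //; exact: dblL_continuous.
    * by apply: onsnd => //; exact: dblR_continuous.
    * by move=> z zh /=; rewrite dblL_half // dblR_half.
  + by rewrite /H /= /concat; case: ifP.
  + by rewrite /H /= /concat; case: ifP.
- move=> t; rewrite /H /= !concat0 !concat1.
  by split; [exact: (hr t).1|exact: (kr t).2].
- have P t s : p (H (t, s)) = p (h (t, one)).
    rewrite /H /concat /=; case: ifP => _; first exact: hv.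
    by rewrite hk; exact: kv.
  by move=> t s s'; rewrite !P.
Qed.

Lemma basic_nbhd_vclass f g (U : set X) (V0 V1 : set Y) :
  basic_nbhd f U V0 V1 (vclass g) <->
  exists h : I * I -> Y,
    [/\ homotopy h f g, forall z, U (p (h z)),
        forall t, V0 (h (t, zero)) & forall t, V1 (h (t, one))].
Proof.
split=> [[g' [/esym/vclassP g'g [h [hfg' hU h0 h1]]]]|[h hP]]; last first.
  by exists g; split=> //; exists h.
have [k [kg'g kr kv]] := g'g; have [e0 e1] := vhomotopic_ends g'g.
have [_ k0 _] := kg'g; have [_ _ hg'] := hfg'.
exists (hcat h k); split.
- exact: hcat_homotopy hfg' kg'g.
- move=> [t s]; apply: (hcat_ind (P := fun y => U (p y))) => u; first exact: hU.
  by rewrite (kv u s zero) (kr u).1 k0 -hg'; exact: hU.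
- by apply: hcat_ind => // u; rewrite (kr u).1 k0 -hg'.
- by apply: hcat_ind => // u; rewrite (kr u).2 k0 -hg'.
Qed.

Lemma varrow_openE (O : set (varrow_space R p BX BY)) :
  open O = varrow_open BX BY O.
Proof. by []. Qed.

Lemma basic_nbhd_open f (U : set X) (V0 V1 : set Y) :
  basic_open BX U -> basic_open BY V0 -> basic_open BY V1 ->
  open (basic_nbhd f U V0 V1 : set (varrow_space R p BX BY)).
Proof.
rewrite varrow_openE => BU BV0 BV1 g /basic_nbhd_vclass[h [hfg hU h0 h1]].
have [_ _ hg] := hfg.
exists U, V0, V1; split; try by split=> //; rewrite -hg.
move=> _ [k [-> [h' [hgk hU' h0' h1']]]]; apply/basic_nbhd_vclass.
exists (hcat h h'); split.
- exact: hcat_homotopy hfg hgk.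
- by move=> [t s]; apply: (hcat_ind (P := fun y => U (p y))).
- exact: hcat_ind.
- exact: hcat_ind.
Qed.

Lemma basic_nbhd_refl f (U : set X) (V0 V1 : set Y) :
  U (p (f zero)) -> V0 (f zero) -> V1 (f one) ->
  basic_nbhd f U V0 V1 (vclass f).
Proof.
move=> Uf V0f V1f; apply/basic_nbhd_vclass; exists (hcst f); split=> //.
  exact/hcst_homotopy/vpath_continuous.
by move=> z; rewrite /hcst (vpath_vertical f z.2 zero).
Qed.

Let joined (O : set Y) (x y : Y) := exists gamma : I -> Y,
  [/\ continuous gamma, gamma zero = x, gamma one = y & forall t, O (gamma t)].

Let joined_trans O x y z : joined O x y -> joined O y z -> joined O x z.
Proof.
move=> [f [cf f0 f1 Of]] [g [cg g0 g1 Og]]; exists (concat f g); split.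
- by apply: concat_continuous => //; rewrite f1 g0.
- by rewrite concat0.
- by rewrite concat1.
- by move=> t; rewrite /concat; case: ifP.
Qed.

Let joined_sym O x y : joined O x y -> joined O y x.
Proof.
move=> [f [cf f0 f1 Of]]; exists (f \o @rev_unitI R); split=> //.
- exact: reverse_continuous.
- by rewrite /= rev_unitI0.
- by rewrite /= rev_unitI1.
- by move=> t; exact: Of.
Qed.

(* Local path-connectedness of the total space is forced by continuity of the
   unit map alone, so it is a necessary condition for [vert_groupoid] to be a
   topological groupoid. *)
Lemma idm_continuous_locally_path_connected :
  continuous (@idm (vert_groupoid R p BX BY)) -> locally_path_connected R Y.
Proof.
move=> cidm x U; rewrite nbhsE => -[O [oO Ox] OU].
have sub y z : joined O y z -> exists gamma : I -> Y,
    [/\ continuous gamma, gamma zero = y, gamma one = z &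
        forall t, joined O y (gamma t)].
  move=> [f [cf f0 f1 Of]]; exists f; split=> // t.
  exists (fun s => f (clampI (valI t * valI s + 0))); split=> //.
  - exact: (comp_continuous (@affine_unitI_continuous R (valI t) 0) cf).
  - by rewrite valI0 mulr0 addr0.
  - by rewrite valI1 mulr1 addr0 clampI_valI.
exists (joined O x); split.
- rewrite openE => y xy.
  have Oy : O y by case: xy => f [_ _ <-].
  have [V [BV Vy VO]] := basis_nbhs BY (open_nbhs_nbhs (conj oO Oy)).
  have [W [BW Wy _]] := basis_nbhs BX (@filterT _ (nbhs (p y)) _).
  have : nbhs (vidm R p y : varrow_space R p BX BY)
      (basic_nbhd (vcst R p y) W V V).
    apply: open_nbhs_nbhs; split; first exact: basic_nbhd_open.
    exact: basic_nbhd_refl.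
  move=> /(cidm y) H; change (nbhs y (joined O x)).
  apply: (@filterS _ (nbhs y) _ _ _ _ H).
  move=> z /basic_nbhd_vclass[h [[ch h0 h1] _ hV _]].
  apply: joined_trans xy _; exists (fun t => h (t, zero)); split.
  + have c0 : continuous (fun t : I => (t, zero : I)).
      apply: pair_continuous; last exact: cst_continuous.
      by move=> t; exact: cvg_id.
    exact: comp_continuous c0 ch.
  + exact: h0.
  + exact: h1.
  + by move=> t; apply: VO.
- by exists (cst x); split=> //; exact: cst_continuous.
- by move=> y [f [_ _ <- Of]]; apply: OU.
- move=> y z xy xz.
  have [f [cf f0 f1 Of]] := sub _ _ (joined_trans (joined_sym xy) xz).
  exists (mk_path cf f0 f1) => t.
  exact: joined_trans xy (Of t).
Qed.

End VerticalTheory.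

(* Main.v *)
(* A square [h] in [Y] expresses that [h (0,-) * h (-,1)] and
   [h (-,0) * h (1,-)] are homotopic paths, and conversely.  Hence [g] lies in
   the basic neighbourhood of [f] given by [U, V0, V1] iff there are paths [a]
   in [V0] and [b] in [V1] with [f * b ~ a * g] in [p^-1 U].  In this form
   concatenation is continuous as soon as every point has neighbourhoods [V]
   whose loops die in [p^-1 U]; over a trivialising open set this follows from
   the same property of [B] and [F], since a fibre homotopy equivalence
   is injective on free homotopy classes of loops.

   Over a trivialising [U] the fibre homotopy equivalence induces continuous
   functors between [Pi_1^vert (p)] restricted to [U] and [Pi_1 (F) x U], and
   the vertical homotopies induce continuous natural transformations from
   both composites to the identities.  Such a pair of functors consists of
   weak equivalences, so the span is [Z|U <- Z|U -> Pi_1 (F) x U]. *)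
Require Import Defs.
From mathcomp Require Import all_boot all_order all_algebra.
From mathcomp Require Import all_classical all_reals topology normedtype.
From mathcomp Require Import homotopy lra.
(* Makes [comp] and [inv] denote the groupoid operations again. *)
Import Defs.
Set Implicit Arguments.
Unset Strict Implicit.
Unset Printing Implicit Defensive.
Import Order.TTheory GRing.Theory Num.Theory.
Import numFieldNormedType.Exports.
Local Open Scope classical_set_scope.
Local Open Scope ring_scope.

(** * Homotopies of paths in a subset *)

Section PathAlgebra.
Variables (R : realType).
Local Notation I := (unitI R).

(** The clamp has no effect here, a convex combination of points of [0,1] being in [0,1]; it only
    supplies the type. *)
Definition lerp (t a b : I) : I :=
  clampI ((1 - valI t) * valI a + valI t * valI b).

Lemma lerp_continuous (S : topologicalType) (t a b : S -> I) :
  continuous t -> continuous a -> continuous b ->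
  continuous (fun s => lerp (t s) (a s) (b s)).
Proof.
move=> ct ca cb.
have cv (u : S -> I) : continuous u -> continuous (fun s => valI (u s) : R).
  by move=> cu; exact: (comp_continuous cu (@valI_continuous R)).
have cD (u v : S -> R) : continuous u -> continuous v ->
    continuous (fun s => u s + v s).
  by move=> cu cv' s; exact: (@continuousD _ R^o S u v s (cu s) (cv' s)).
have cM (u v : S -> R) : continuous u -> continuous v ->
    continuous (fun s => u s * v s).
  by move=> cu cv' s; exact: (@continuousM R S u v s (cu s) (cv' s)).
have c1t : continuous (fun s => 1 - valI (t s)).
  have := comp_continuous (cv _ ct) (@affine_continuous R (-1) 1).
  rewrite (_ : _ \o _ = fun s => 1 - valI (t s)) //.
  by apply/funext => s /=; rewrite mulN1r addrC.
apply: (comp_continuous (f := fun s => (1 - valI (t s)) * valI (a s) +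
  valI (t s) * valI (b s))); last exact: clampI_continuous.
by apply: cD; apply: cM => //; exact: cv.
Qed.

Lemma lerp0 a b : lerp zero a b = a.
Proof. by rewrite /lerp valI0 subr0 mul1r mul0r addr0 clampI_valI. Qed.

Lemma lerp1 a b : lerp one a b = b.
Proof. by rewrite /lerp valI1 subrr mul0r mul1r add0r clampI_valI. Qed.

Lemma lerpxx t a : lerp t a a = a.
Proof. by rewrite /lerp -mulrDl subrK mul1r clampI_valI. Qed.

(** Right inverses of [dblL] and [dblR]. Through them a reassociated concatenation becomes a
    reparametrisation of a single path. *)
Definition halfL (t : I) : I := clampI (2^-1 * valI t + 0).
Definition halfR (t : I) : I := clampI (2^-1 * valI t + 2^-1).

Lemma halfL_continuous : continuous halfL.
Proof. exact: affine_unitI_continuous. Qed.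

Lemma halfR_continuous : continuous halfR.
Proof. exact: affine_unitI_continuous. Qed.

Lemma valI_halfL t : valI (halfL t) = 2^-1 * valI t.
Proof.
have := valI_ge0 t; have := valI_le1 t => t1 t0.
by rewrite valI_clampI ?addr0//; apply/andP; split; lra.
Qed.

Lemma valI_halfR t : valI (halfR t) = 2^-1 * valI t + 2^-1.
Proof.
have := valI_ge0 t; have := valI_le1 t => t1 t0.
by rewrite valI_clampI //; apply/andP; split; lra.
Qed.

Lemma concat_halfL (X : Type) (f g : I -> X) t : concat f g (halfL t) = f t.
Proof.
have t1 := valI_le1 t; rewrite /concat valI_halfL ifT; last by lra.
congr f; apply/valI_inj.
by rewrite /dblL valI_halfL mulrA divff ?pnatr_eq0// mul1r clampI_valI.
Qed.

Lemma concat_halfR (X : Type) (f g : I -> X) t :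
  f one = g zero -> concat f g (halfR t) = g t.
Proof.
move=> fg; have t0 := valI_ge0 t; rewrite /concat valI_halfR; case: ifPn => t1.
  (* At the midpoint [concat] reads its first path, so t = 0 is settled by the matching
     condition. *)
  have tz : valI t = 0 by lra.
  have -> : t = zero by apply/valI_inj; rewrite tz valI0.
  rewrite -fg; congr f; rewrite dblL_half // valI_halfR valI0; lra.
congr g; apply/valI_inj; rewrite /dblR valI_halfR.
rewrite (_ : 2 * (2^-1 * valI t + 2^-1) - 1 = valI t) ?clampI_valI//; lra.
Qed.

Lemma concat_map (X Y : Type) (m : X -> Y) (f g : I -> X) :
  m \o concat f g = concat (m \o f) (m \o g).
Proof. by apply/funext => t /=; rewrite /concat; case: ifP. Qed.

Lemma halfL0 : halfL zero = zero.
Proof. by apply/valI_inj; rewrite valI_halfL valI0 mulr0. Qed.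

Lemma halfR1 : halfR one = one.
Proof. by apply/valI_inj; rewrite valI_halfR valI1; lra. Qed.

Lemma halfL1_halfR0 : halfL one = halfR zero.
Proof.
by apply/valI_inj; rewrite valI_halfR valI_halfL valI0 valI1 mulr0 add0r mulr1.
Qed.

Lemma row_continuous (S T X : topologicalType) (h : S * T -> X) s :
  continuous h -> continuous (fun t => h (s, t)).
Proof.
move=> ch; apply: (comp_continuous (f := fun t => (s, t)) _ ch).
by apply: pair_continuous; [exact: cst_continuous|move=> t; exact: cvg_id].
Qed.

Lemma column_continuous (S T X : topologicalType) (h : S * T -> X) t :
  continuous h -> continuous (fun s => h (s, t)).
Proof.
move=> ch; apply: (comp_continuous (f := fun s => (s, t)) _ ch).
by apply: pair_continuous; [move=> s; exact: cvg_id|exact: cst_continuous].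
Qed.

Section OneSpace.
Variables (X : topologicalType).
Implicit Types (A : set X) (f g k : I -> X).

Definition path_in A f := continuous f /\ forall t, A (f t).

Lemma path_in_cst A x : A x -> path_in A (cst x : I -> X).
Proof. by move=> Ax; split=> //; exact: cst_continuous. Qed.

Lemma path_in_concat A f g :
  path_in A f -> path_in A g -> f one = g zero -> path_in A (concat f g).
Proof.
move=> [cf Af] [cg Ag] fg; split; first exact: concat_continuous.
by move=> t; rewrite /concat; case: ifP.
Qed.

Lemma path_in_rev A f : path_in A f -> path_in A (f \o @rev_unitI R).
Proof.
by move=> [cf Af]; split=> [|t]; [exact: reverse_continuous|exact: Af].
Qed.

Lemma path_inS A A' f : A `<=` A' -> path_in A f -> path_in A' f.
Proof. by move=> AA [cf Af]; split=> // t; exact: AA. Qed.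

Local Notation ph := (@path_homotopic_in R X).

Lemma ph_ends A f g : ph A f g -> f zero = g zero /\ f one = g one.
Proof.
move=> [h [[_ h0 h1] hr _]].
by split; [rewrite -h0 -h1 (hr one).1|rewrite -h0 -h1 (hr one).2].
Qed.

Lemma ph_refl A f : path_in A f -> ph A f f.
Proof.
move=> [cf Af]; exists (hcst f); split=> // [|z]; first exact: hcst_homotopy.
exact: Af.
Qed.

Lemma ph_sym A f g : ph A f g -> ph A g f.
Proof.
move=> [h [hfg hr hA]]; exists (hrev h); split.
- exact: hrev_homotopy.
- move=> t; rewrite /hrev /= rev_unitI0.
  by split; [rewrite !(hr _).1|rewrite !(hr _).2].
- by move=> z; exact: hA.
Qed.

Lemma ph_trans A f g k : ph A f g -> ph A g k -> ph A f k.
Proof.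
move=> [h [hfg hr hA]] [h' [hgk hr' hA']]; exists (hcat h h'); split.
- exact: hcat_homotopy hfg hgk.
- have [_ h0 h1] := hfg; have [_ h'0 h'1] := hgk.
  move=> t; rewrite /hcat /= !concat0 /concat; split; case: ifP => _.
  + exact: (hr _).1.
  + by rewrite (hr' _).1 h'0 -h1 (hr _).1.
  + exact: (hr _).2.
  + by rewrite (hr' _).2 h'0 -h1 (hr _).2.
- by move=> [t s]; exact: hcat_ind.
Qed.

Lemma phS A A' f g : A `<=` A' -> ph A f g -> ph A' f g.
Proof. by move=> AA [h [? ? hA]]; exists h; split=> // z; exact: AA. Qed.

(* The straight-line homotopy from [e] to [e'] in the convex set [I * I]. *)
Lemma ph_convex A (h : I * I -> X) (e e' : I -> I * I) :
  continuous h -> (forall z, A (h z)) -> continuous e -> continuous e' ->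
  e zero = e' zero -> e one = e' one -> ph A (h \o e) (h \o e').
Proof.
move=> ch hA ce ce' e0 e1.
pose L (z : I * I) :=
  (lerp z.1 (e z.2).1 (e' z.2).1, lerp z.1 (e z.2).2 (e' z.2).2).
have c1 := @fst_continuous I I; have c2 := @snd_continuous I I.
have cL : continuous L.
  have ce2 := comp_continuous c2 ce; have ce2' := comp_continuous c2 ce'.
  apply: pair_continuous.
    exact: (lerp_continuous c1 (comp_continuous ce2 c1)
      (comp_continuous ce2' c1)).
  exact: (lerp_continuous c1 (comp_continuous ce2 c2)
    (comp_continuous ce2' c2)).
exists (h \o L); split.
- split; first exact: comp_continuous cL ch.
  + by move=> s; rewrite /= /L /= !lerp0 -surjective_pairing.
  + by move=> s; rewrite /= /L /= !lerp1 -surjective_pairing.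
- by move=> t; rewrite /= /L /= !e0 !e1 !lerpxx.
- by move=> z; exact: hA.
Qed.

(** The unit, inverse and associativity laws below are all instances: both sides are one path
    precomposed with two self-maps of I that agree at the ends. *)
Lemma ph_reparam A f (u v : I -> I) :
  path_in A f -> continuous u -> continuous v ->
  u zero = v zero -> u one = v one -> ph A (f \o u) (f \o v).
Proof.
move=> [cf Af] cu cv u0 u1.
(* The square is mapped by [f \o fst], and u and v become paths on its diagonal; the second
   coordinate is a dummy. *)
apply: (@ph_convex A (f \o fst) (fun s => (u s, u s)) (fun s => (v s, v s))).
- exact: comp_continuous (@fst_continuous _ _) cf.
- by move=> z; exact: Af.
- exact: pair_continuous.
- exact: pair_continuous.
- by rewrite u0.
- by rewrite u1.
Qed.

Lemma concat_family_continuous (h k : I * I -> X) :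
  continuous h -> continuous k -> (forall t, h (t, one) = k (t, zero)) ->
  continuous (fun z => concat (fun s => h (z.1, s)) (fun s => k (z.1, s)) z.2).
Proof.
move=> ch ck hk.
have onsnd (u : I -> I) (l : I * I -> X) : continuous u -> continuous l ->
    continuous (fun z => l (z.1, u z.2)).
  move=> cu cl; have c : continuous (fun z : I * I => (z.1, u z.2)).
    apply: pair_continuous; first exact: fst_continuous.
    exact: comp_continuous (@snd_continuous _ _) cu.
  exact: comp_continuous c cl.
apply: (@pasting _ _ _ (fun z => valI z.2) 2^-1
  (fun z => h (z.1, dblL z.2)) (fun z => k (z.1, dblR z.2))).
- exact: comp_continuous (@snd_continuous _ _) (@valI_continuous R).
- by apply: onsnd => //; exact: dblL_continuous.
- by apply: onsnd => //; exact: dblR_continuous.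
- by move=> z zh /=; rewrite dblL_half // dblR_half.
Qed.

Lemma ph_concat A f f' g g' : f one = g zero ->
  ph A f f' -> ph A g g' -> ph A (concat f g) (concat f' g').
Proof.
move=> fg [h [[ch h0 h1] hr hA]] [k [[ck k0 k1] kr kA]].
have hk t : h (t, one) = k (t, zero).
  by rewrite (hr t).2 (kr t).1 h0 k0.
exists (fun z => concat (fun s => h (z.1, s)) (fun s => k (z.1, s)) z.2); split.
- split=> [|s|s]; first exact: concat_family_continuous.
  + by rewrite /= /concat; case: ifP.
  + by rewrite /= /concat; case: ifP.
- move=> t; rewrite /= !concat0 !concat1.
  by split; [exact: (hr t).1|exact: (kr t).2].
- by move=> [t s]; rewrite /concat /=; case: ifP.
Qed.

Let idI_continuous : continuous (@id I).
Proof. by move=> s; exact: cvg_id. Qed.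

Let cstI_continuous (x : I) : continuous (cst x : I -> I).
Proof. exact: cst_continuous. Qed.

Lemma ph1m A f : path_in A f -> ph A (concat (cst (f zero)) f) f.
Proof.
move=> Af; have -> : concat (cst (f zero)) f = f \o concat (cst zero) id.
  by rewrite concat_map.
have := @ph_reparam A f (concat (cst zero) id) id Af; apply => //.
- exact: concat_continuous.
- by rewrite concat0.
- by rewrite concat1.
Qed.

Lemma phm1 A f : path_in A f -> ph A (concat f (cst (f one))) f.
Proof.
move=> Af; have -> : concat f (cst (f one)) = f \o concat id (cst one).
  by rewrite concat_map.
have := @ph_reparam A f (concat id (cst one)) id Af; apply => //.
- exact: concat_continuous.
- by rewrite concat0.
- by rewrite concat1.
Qed.

Lemma phmV A f : path_in A f ->
  ph A (concat f (f \o @rev_unitI R)) (cst (f zero)).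
Proof.
move=> Af; rewrite -[f in concat f _]/(f \o id) -concat_map.
apply: (@ph_reparam A f (concat id (@rev_unitI R)) (cst zero) Af) => //.
- apply: concat_continuous => //; first exact: rev_unitI_continuous.
  by rewrite rev_unitI0.
- by rewrite concat0.
- by rewrite concat1 rev_unitI1.
Qed.

Lemma phVm A f : path_in A f ->
  ph A (concat (f \o @rev_unitI R) f) (cst (f one)).
Proof.
move=> Af; rewrite -[f in concat _ f]/(f \o id) -concat_map.
apply: (@ph_reparam A f (concat (@rev_unitI R) id) (cst one) Af) => //.
- apply: concat_continuous => //; first exact: rev_unitI_continuous.
  by rewrite rev_unitI1.
- by rewrite concat0 rev_unitI0.
- by rewrite concat1.
Qed.

Lemma phA A f g k : path_in A f -> path_in A g -> path_in A k ->
  f one = g zero -> g one = k zero ->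
  ph A (concat (concat f g) k) (concat f (concat g k)).
Proof.
move=> Af Ag Ak fg gk; pose M := concat f (concat g k).
have fgk : f one = concat g k zero by rewrite concat0.
have cL := halfL_continuous; have cR := halfR_continuous.
(* In M the path f fills the first half, g the third quarter and k the last quarter; u runs through
   these pieces at the speeds of the other bracketing. *)
pose u := concat (concat halfL (halfR \o halfL)) (halfR \o halfR).
have -> : concat (concat f g) k = M \o u.
  rewrite !concat_map; congr (concat (concat _ _) _); apply/funext => t;
    rewrite /= /M.
  - by rewrite concat_halfL.
  - by rewrite concat_halfR // concat_halfL.
  - by rewrite concat_halfR // concat_halfR.
have AM : path_in A M by apply: path_in_concat => //; exact: path_in_concat.
have e1 : halfL one = (halfR \o halfL) zero.
  by rewrite /= halfL0 halfL1_halfR0.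
have e2 : concat halfL (halfR \o halfL) one = (halfR \o halfR) zero.
  by rewrite concat1 /= halfL1_halfR0.
have := @ph_reparam A M u id AM; apply => //.
- apply: concat_continuous => //; last exact: comp_continuous.
  by apply: concat_continuous => //; exact: comp_continuous.
- by rewrite /u !concat0 halfL0.
- by rewrite /u concat1 /= !halfR1.
Qed.

(** The two ways along the boundary of I * I from (0,0) to (1,1) are joined by a straight-line
    homotopy, which h carries into A. *)
Lemma ph_square A (h : I * I -> X) : continuous h -> (forall z, A (h z)) ->
  ph A (concat (fun s => h (zero, s)) (fun t => h (t, one)))
       (concat (fun t => h (t, zero)) (fun s => h (one, s))).
Proof.
move=> ch hA.
have -> : concat (fun s => h (zero, s)) (fun t => h (t, one)) =
  h \o concat (fun s => (zero, s)) (fun t => (t, one)) by rewrite concat_map.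
have -> : concat (fun t => h (t, zero)) (fun s => h (one, s)) =
  h \o concat (fun t => (t, zero)) (fun s => (one, s)) by rewrite concat_map.
apply: ph_convex => //.
- apply: concat_continuous => //.
    exact: (@pair_continuous I I I (cst zero) id).
  exact: (@pair_continuous I I I id (cst one)).
- apply: concat_continuous => //.
    exact: (@pair_continuous I I I id (cst zero)).
  exact: (@pair_continuous I I I (cst one) id).
- by rewrite !concat0.
- by rewrite !concat1.
Qed.

End OneSpace.
End PathAlgebra.

(** * Squares of paths *)

Section Squares.
Variables (R : realType) (X : topologicalType).
Local Notation I := (unitI R).
Local Notation ph := (@path_homotopic_in R X).
Implicit Types (A V : set X) (f g k : I -> X).

(** The chain is f ~ f * (g^-1 * g) ~ (f * g^-1) * g ~ g. *)
Lemma ph_loop_trivial A f g :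
  path_in A f -> path_in A g -> f zero = g zero -> f one = g one ->
  ph A (concat f (g \o @rev_unitI R)) (cst (f zero)) -> ph A f g.
Proof.
move=> Af Ag fg0 fg1 fgV; have AgV := path_in_rev Ag.
have e : f one = (g \o @rev_unitI R) zero by rewrite /= rev_unitI0.
have e' : (g \o @rev_unitI R) one = g zero by rewrite /= rev_unitI1.
apply: ph_trans (ph_sym (phm1 Af)) _.
apply: (ph_trans (g := concat f (concat (g \o @rev_unitI R) g))).
  apply: ph_concat => //; first exact: ph_refl.
  by rewrite fg1; exact/ph_sym/phVm.
apply: ph_trans (ph_sym (phA Af AgV Ag e e')) _.
apply: (ph_trans (g := concat (cst (g zero)) g)); last exact: ph1m.
apply: ph_concat; [by rewrite concat1| by rewrite -fg0|exact: ph_refl].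
Qed.

(** The relation behind [basic_nbhd], with A in the role of p^-1(U), for bare paths instead of
    classes of vertical ones. *)
Definition square_homotopic A V0 V1 f g :=
  exists h : I * I -> X, [/\ homotopy h f g, forall z, A (h z),
    forall t, V0 (h (t, zero)) & forall t, V1 (h (t, one))].

Lemma square_trans A V0 V1 f g k : square_homotopic A V0 V1 f g ->
  square_homotopic A V0 V1 g k -> square_homotopic A V0 V1 f k.
Proof.
move=> [h [hfg hA h0 h1]] [h' [hgk hA' h0' h1']]; exists (hcat h h'); split.
- exact: hcat_homotopy hfg hgk.
- by move=> [t s]; exact: hcat_ind.
- exact: hcat_ind.
- exact: hcat_ind.
Qed.

Lemma ph_square_homotopic A V0 V1 f g :
  V0 (f zero) -> V1 (f one) -> ph A f g -> square_homotopic A V0 V1 f g.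
Proof.
move=> V0f V1f [h [hfg hr hA]]; have [_ h0 _] := hfg.
by exists h; split=> // t; rewrite ?(hr t).1 ?(hr t).2 h0.
Qed.

Lemma square_homotopic_rev A V0 V1 f g : square_homotopic A V0 V1 f g ->
  square_homotopic A V1 V0 (f \o @rev_unitI R) (g \o @rev_unitI R).
Proof.
move=> [h [[ch h0 h1] hA hV0 hV1]].
exists (fun z => h (z.1, rev_unitI z.2)); split=> //.
- split=> [|s|s]; [|exact: h0|exact: h1].
  have c : continuous (fun z : I * I => (z.1, rev_unitI z.2)).
    apply: pair_continuous; first exact: fst_continuous.
    exact: comp_continuous (@snd_continuous _ _) (@rev_unitI_continuous R).
  exact: comp_continuous c ch.
- by move=> t /=; rewrite rev_unitI0.
- by move=> t /=; rewrite rev_unitI1.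
Qed.

(** The paths a and b are the traces of the two endpoints, and [ph_square] compares the two ways
    round. With [square_homotopic_fill] this turns squares into an identity of path classes, which
    can be pasted algebraically. *)
Lemma square_homotopic_sides A V0 V1 f g : square_homotopic A V0 V1 f g ->
  exists a b, [/\ path_in (A `&` V0) a, path_in (A `&` V1) b,
    a zero = f zero /\ a one = g zero, b zero = f one /\ b one = g one &
    ph A (concat f b) (concat a g)].
Proof.
move=> [h [[ch h0 h1] hA hV0 hV1]].
exists (fun t => h (t, zero)), (fun t => h (t, one)); split=> //.
- by split=> [|t]; [exact: column_continuous|split].
- by split=> [|t]; [exact: column_continuous|split].
- have -> : f = fun s => h (zero, s) by apply/funext => s; rewrite h0.
  have -> : g = fun s => h (one, s) by apply/funext => s; rewrite h1.
  exact: ph_square.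
Qed.

(* [f] is homotopic to [a * g * b^-1], which shrinks to [g] by sliding along
   [a] and [b]. *)
Lemma square_homotopic_fill A V0 V1 f g a b :
  path_in A f -> path_in A g ->
  path_in (A `&` V0) a -> path_in (A `&` V1) b ->
  a zero = f zero -> a one = g zero -> b zero = f one -> b one = g one ->
  ph A (concat f b) (concat a g) -> square_homotopic A V0 V1 f g.
Proof.
move=> Af Ag Va Vb a0 a1 b0 b1 fbag.
have Aa : path_in A a by apply: path_inS Va => x [].
have Ab : path_in A b by apply: path_inS Vb => x [].
have AbV := path_in_rev Ab; have eb : b one = (b \o @rev_unitI R) zero.
  by rewrite /= rev_unitI0.
have Aag : path_in A (concat a g) by exact: path_in_concat.
pose k := concat (concat a g) (b \o @rev_unitI R).
have fk : ph A f k.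
  apply: ph_trans (ph_sym (phm1 Af)) _; rewrite -b0.
  apply: (ph_trans (g := concat f (concat b (b \o @rev_unitI R)))).
    apply: ph_concat => //; first exact: ph_refl.
    exact/ph_sym/phmV.
  apply: ph_trans (ph_sym (phA Af Ab AbV (esym b0) eb)) _.
  by apply: ph_concat => //; [rewrite concat1|exact: ph_refl].
have [ca VVa] := Va; have [cb VVb] := Vb; have [cg Ag'] := Ag.
apply: (square_trans (g := k)).
  apply: ph_square_homotopic fk; first by rewrite -a0; have [] := VVa zero.
  by rewrite -b0; have [] := VVb zero.
pose l := concat (concat (cst (g zero)) g) (cst (g one)).
apply: (square_trans (g := l)); last first.
  apply: ph_square_homotopic.
  - by rewrite /l !concat0 /= -a1; have [] := VVa one.
  - by rewrite /l concat1 /= -b1; have [] := VVb one.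
  apply: (ph_trans (g := concat g (cst (g one)))); last exact: phm1.
  by apply: ph_concat; [rewrite concat1|exact: ph1m|exact/ph_refl/path_in_cst].
have c1 := @fst_continuous I I; have c2 := @snd_continuous I I.
have lA : continuous (fun z : I * I => lerp z.2 z.1 one).
  by apply: (lerp_continuous c2 c1); exact: cst_continuous.
have lB : continuous (fun z : I * I => lerp z.2 one z.1).
  by apply: (lerp_continuous c2 _ c1); exact: cst_continuous.
(* At time t the path runs along a from a(t) to a(1), then along g, then back along b from b(1) to
   b(t). This is k at t = 0 and l at t = 1. *)
pose h1 (z : I * I) := concat (fun s => a (lerp s z.1 one)) g z.2.
have ch1 : continuous h1.
  apply: (@concat_family_continuous _ _ (fun z => a (lerp z.2 z.1 one))
    (fun z => g z.2)).
  - exact: (comp_continuous lA ca).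
  - exact: (comp_continuous c2 cg).
  - by move=> t; rewrite /= lerp1.
pose h (z : I * I) :=
  concat (fun s => h1 (z.1, s)) (fun s => b (lerp s one z.1)) z.2.
exists h; split.
- split.
  + apply: (@concat_family_continuous _ _ h1 (fun z => b (lerp z.2 one z.1))).
    * exact: ch1.
    * exact: (comp_continuous lB cb).
    * by move=> t; rewrite /h1 /= concat1 lerp0 b1.
  + move=> s; rewrite /h /h1 /k /=; congr (concat (concat _ _) _ _).
      apply/funext => t; congr a; apply/valI_inj.
      by rewrite /lerp valI0 valI1 mulr0 add0r mulr1 clampI_valI.
    apply/funext => t; congr b; rewrite /lerp valI0 valI1 mulr0 addr0 mulr1.
    by [].
  + by move=> s; rewrite /h /h1 /l /=; congr (concat (concat _ _) _ _);
      apply/funext => t; rewrite lerpxx.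
- move=> [t s]; rewrite /h /h1 /concat /=.
  by case: ifP => _; [case: ifP => _|]; [exact: Aa.2|exact: Ag'|exact: Ab.2].
- by move=> t; rewrite /h /h1 !concat0 /= lerp0; have [] := VVa t.
- by move=> t; rewrite /h concat1 /= lerp1; have [] := VVb t.
Qed.

(** The condition of [pi1_trivial_in], for bare functions with equal ends instead of bundled
    paths. *)
Definition loops_trivial_in V A :=
  forall f, path_in V f -> f zero = f one -> ph A f (cst (f zero)).

(** The two squares share their middle corners, but their middle edges b and b' may differ. Both are
    paths in V1 with the same ends, so they are homotopic in A, and the squares paste: f * g * c ~ f
    * b' * g' ~ f * b * g' ~ a * f' * g'. *)
Lemma square_homotopic_concat A V0 V1 V2 f f' g g' :
  loops_trivial_in V1 A ->
  path_in A f -> path_in A f' -> path_in A g -> path_in A g' ->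
  f one = g zero -> f' one = g' zero ->
  square_homotopic A V0 V1 f f' -> square_homotopic A V1 V2 g g' ->
  square_homotopic A V0 V2 (concat f g) (concat f' g').
Proof.
move=> tV Af Af' Ag Ag' fg fg'.
move=> /square_homotopic_sides[a [b [Va Vb [a0 a1] [b0 b1] fb]]].
move=> /square_homotopic_sides[b' [c [Vb' Vc [b'0 b'1] [c0 c1] gc]]].
have Aa : path_in A a by apply: path_inS Va => x [].
have Ab : path_in A b by apply: path_inS Vb => x [].
have Ab' : path_in A b' by apply: path_inS Vb' => x [].
have Ac : path_in A c by apply: path_inS Vc => x [].
have bb' : ph A b b'.
  apply: ph_loop_trivial => //; rewrite ?b'0 ?b'1 ?b0 ?b1 //.
  rewrite -b0 -[b zero](concat0 b (b' \o @rev_unitI R)).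
  apply: tV; last by rewrite concat0 concat1 /= rev_unitI1 b0 b'0.
  apply: path_in_concat; last by rewrite /= rev_unitI0 b1 b'1.
    by apply: path_inS Vb => x [].
  by apply: path_in_rev; apply: path_inS Vb' => x [].
apply: (square_homotopic_fill (a := a) (b := c)) => //;
  try exact: path_in_concat; rewrite ?concat0 ?concat1 //.
apply: ph_trans (phA Af Ag Ac fg (esym c0)) _.
apply: (ph_trans (g := concat f (concat b' g'))).
  by apply: ph_concat; [rewrite concat0|exact: ph_refl|].
apply: ph_trans (ph_sym (phA Af Ab' Ag' _ b'1)) _; first by rewrite b'0.
apply: ph_trans _ (phA Aa Af' Ag' a1 fg').
apply: ph_concat; [by rewrite concat1| |exact: ph_refl].
apply: ph_trans fb; apply: ph_concat; [by rewrite b'0|exact: ph_refl|].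
exact: ph_sym.
Qed.

End Squares.

(** * The vertical fundamental groupoid *)

Section VerticalPathClasses.
Variables (R : realType) (Y X : topologicalType) (p : Y -> X).
Local Notation I := (unitI R).
Local Notation ph := (@path_homotopic_in R Y).
Local Notation fibre b := (p @^-1` [set b]).
Implicit Types (f g : vpath R p) (a : varrow R p).

(** A homotopy relative to the endpoints through vertical paths never leaves the fibre of its
    starting point. Hence the laws for path homotopies in a subset apply to vertical classes. *)
Lemma vhomotopicP b f g : p (f zero) = b -> vhomotopic f g <-> ph (fibre b) f g.
Proof.
move=> fb; split=> [[h [hfg hr hv]]|[h [hfg hr hA]]].
  have [_ h0 _] := hfg; exists h; split=> // -[t s].
  by rewrite /= (hv t s zero) (hr t).1 h0.
by exists h; split=> // t s s'; rewrite (hA (t, s)) (hA (t, s')).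
Qed.

Lemma vclass_eqP b f g :
  p (f zero) = b -> vclass f = vclass g <-> ph (fibre b) f g.
Proof. by move=> fb; rewrite vclassP; exact: vhomotopicP. Qed.

Lemma repr_ph b f : p (f zero) = b -> ph (fibre b) (repr (vclass f)) f.
Proof.
move=> fb; have H := repr_vclass f; apply/vhomotopicP => //.
by rewrite (vhomotopic_ends H).1.
Qed.

Lemma vpath_in b f : p (f zero) = b -> path_in (fibre b) f.
Proof.
move=> fb; split; first exact: vpath_continuous.
by move=> t; rewrite /= (vpath_vertical f t zero).
Qed.

Lemma vclassK a : vclass (repr a) = a.
Proof. exact: reprK. Qed.

Lemma vclass_repr_eq b f a : p (f zero) = b ->
  ph (fibre b) f (repr a) -> vclass f = a.
Proof. by move=> fb fa; rewrite -[RHS]vclassK; apply/vclass_eqP/fa. Qed.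

Lemma vpath_end f : p (f one) = p (f zero).
Proof. exact: vpath_vertical. Qed.

(** Spares comparing the proofs of continuity and verticality carried by the two records. *)
Lemma vclass_ext f g : f =1 g -> vclass f = vclass g.
Proof.
move=> /funext fg; apply/(@vclass_eqP (p (f zero))) => //.
by rewrite -fg; apply: ph_refl; exact: vpath_in.
Qed.

End VerticalPathClasses.

Lemma continuous_nbhs (S T : topologicalType) (f : S -> T) x W :
  continuous f -> nbhs (f x) W -> nbhs x (f @^-1` W).
Proof. by move=> cf; exact: cf. Qed.

(** * Continuity of the structure maps *)

Section VerticalTopology.
Variables (R : realType) (Y X : topologicalType) (p : Y -> X).
Variables (BX : open_basis X) (BY : open_basis Y).
Local Notation I := (unitI R).
Local Notation ph := (@path_homotopic_in R Y).
Local Notation arrows := (varrow_space R p BX BY).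
Implicit Types (f g : vpath R p) (a : varrow R p).

(** Shrinking each set to a basic open one gives a smaller basic neighbourhood. With [nbhs_varrow]
    in the other direction, the continuity proofs no longer refer to the chosen bases. *)
Lemma nbhs_basic_nbhd f U V0 V1 :
  nbhs (p (f zero)) U -> nbhs (f zero) V0 -> nbhs (f one) V1 ->
  nbhs (vclass f : arrows) (basic_nbhd f U V0 V1).
Proof.
move=> /(basis_nbhs BX)[U' [BU' U'f UU']] /(basis_nbhs BY)[W0 [BW0 W0f WV0]].
move=> /(basis_nbhs BY)[W1 [BW1 W1f WV1]].
have H := @basic_nbhdS R Y X p f _ _ _ _ _ _ UU' WV0 WV1.
rewrite nbhsE; exists (basic_nbhd f U' W0 W1) => //; split.
  exact: basic_nbhd_open.
exact: basic_nbhd_refl.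
Qed.

Lemma nbhs_varrow f (W : set arrows) : nbhs (vclass f : arrows) W ->
  exists U V0 V1, [/\ open U /\ U (p (f zero)), open V0 /\ V0 (f zero),
    open V1 /\ V1 (f one) & basic_nbhd f U V0 V1 `<=` W].
Proof.
rewrite nbhsE => -[O [oO Of] OW].
move: oO; rewrite varrow_openE.
move=> /(_ f Of)[U [V0 [V1 [[BU Uf] [B0 V0f] [B1 V1f] s]]]].
exists U, V0, V1; split=> //.
- by split=> //; exact: basis_open BU.
- by split=> //; exact: basis_open B0.
- by split=> //; exact: basis_open B1.
- exact: subset_trans s OW.
Qed.

Lemma basic_nbhdP f a U V0 V1 : basic_nbhd f U V0 V1 a <->
  square_homotopic (p @^-1` U) V0 V1 f (repr a).
Proof. by rewrite -[a in X in X <-> _]vclassK; exact: basic_nbhd_vclass. Qed.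

Lemma vsrc_continuous : continuous (@vsrc R Y X p : arrows -> Y).
Proof.
move=> a W /= aW; rewrite /= -[a]vclassK.
have /= : nbhs (vclass (repr a) : arrows) (basic_nbhd (repr a) setT W setT).
  by apply: nbhs_basic_nbhd => //; exact: filterT.
apply: (@filterS _ (nbhs (vclass (repr a) : arrows))).
move=> c /basic_nbhdP[h [[_ _ h1] _ + _]] => /(_ one).
by rewrite h1.
Qed.

Lemma vtgt_continuous : continuous (@vtgt R Y X p : arrows -> Y).
Proof.
move=> a W /= aW; rewrite /= -[a]vclassK.
have /= : nbhs (vclass (repr a) : arrows) (basic_nbhd (repr a) setT setT W).
  by apply: nbhs_basic_nbhd => //; exact: filterT.
apply: (@filterS _ (nbhs (vclass (repr a) : arrows))).
move=> c /basic_nbhdP[h [[_ _ h1] _ _]] => /(_ one).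
by rewrite h1.
Qed.

Lemma vinv_continuous : continuous (@vinv R Y X p : arrows -> arrows).
Proof.
move=> a W /nbhs_varrow[U [V0 [V1 [[oU Uf] [oV0 V0f] [oV1 V1f] sW]]]].
rewrite /= -[a]vclassK; move: Uf V0f V1f.
rewrite /= rev_unitI0 rev_unitI1 => Uf V0f V1f.
have : nbhs (vclass (repr a) : arrows) (basic_nbhd (repr a) U V1 V0).
  apply: nbhs_basic_nbhd; apply: open_nbhs_nbhs; split=> //.
  by rewrite -vpath_end.
apply: (@filterS _ (nbhs (vclass (repr a) : arrows))).
move=> c /basic_nbhdP H; apply: sW; apply/basic_nbhd_vclass.
exact: square_homotopic_rev H.
Qed.

(* A continuous family of vertical paths induces a continuous family of
   arrows as soon as the parameter space is locally path-connected, since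
   the basic neighbourhoods demand homotopies of paths. *)
Lemma vclass_family_continuous (T : topologicalType) (l : I * T -> Y)
    (f : T -> vpath R p) :
  continuous p -> locally_path_connected R T -> continuous l ->
  (forall t s, f t s = l (s, t)) -> continuous (fun t => vclass (f t) : arrows).
Proof.
move=> cp lT cl fl t W.
move=> /nbhs_varrow[U [V0 [V1 [[oU Uf] [oV0 V0f] [oV1 V1f] sW]]]].
have cf s : continuous (fun t => f t s).
  have -> : (fun t => f t s) = l \o (fun t => (s, t)).
    by apply/funext => u; rewrite fl.
  exact: row_continuous.
have N : nbhs t [set u | [/\ U (p (f u zero)), V0 (f u zero) & V1 (f u one)]].
  have N1 : nbhs t [set u | V0 (f u zero)] :=
    cf zero t V0 (open_nbhs_nbhs (conj oV0 V0f)).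
  have N2 : nbhs t [set u | V1 (f u one)] :=
    cf one t V1 (open_nbhs_nbhs (conj oV1 V1f)).
  have N3 : nbhs t [set u | U (p (f u zero))] :=
    comp_continuous (cf zero) cp (open_nbhs_nbhs (conj oU Uf)).
  rewrite (_ : [set u | _] = [set u | U (p (f u zero))] `&`
    ([set u | V0 (f u zero)] `&` [set u | V1 (f u one)])).
    by apply: filterI => //; exact: filterI.
  by apply/seteqP; split=> [u []|u [? []]].
have [V [oV Vt VN Vpc]] := lT _ _ N.
apply: (@filterS _ (nbhs t) _ V); last exact: open_nbhs_nbhs.
move=> u Vu; apply: sW; apply/basic_nbhd_vclass.
have [gam Vgam] := Vpc _ _ Vt Vu.
have cgam : continuous gam by exact: cts_fun.
have g0 : gam zero = t by exact: path_zero.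
have g1 : gam one = u by exact: path_one.
(* Moving the parameter along [gam] deforms f t into f u through members of the family. *)
exists (fun z => l (z.2, gam z.1)); split.
- split.
  + apply: (comp_continuous (f := fun z : I * I => (z.2, gam z.1)) _ cl).
    apply: pair_continuous; first exact: snd_continuous.
    exact: (comp_continuous (@fst_continuous _ _) cgam).
  + by move=> s; rewrite /= g0 fl.
  + by move=> s; rewrite /= g1 fl.
- move=> [r s]; rewrite /= -fl (vpath_vertical _ s zero).
  by have [] := VN _ (Vgam r).
- by move=> r; rewrite /= -fl; have [] := VN _ (Vgam r).
- by move=> r; rewrite /= -fl; have [] := VN _ (Vgam r).
Qed.

(** A relative form of semilocal simple connectedness. The loops in V need not be vertical, and they
    contract in p^-1(U), where the homotopies of a basic neighbourhood live. *)
Definition locally_loop_trivial :=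
  forall (y : Y) (U : set X), open U -> U (p y) ->
    exists V, [/\ open V, V y & loops_trivial_in R V (p @^-1` U)].

Hypothesis p_continuous : continuous p.
Hypothesis Y_lpc : locally_path_connected R Y.
Hypothesis Y_llt : locally_loop_trivial.

Lemma vidm_continuous : continuous (@vidm R Y X p : Y -> arrows).
Proof.
apply: (@vclass_family_continuous _ snd) => //; exact: snd_continuous.
Qed.

Lemma vcomp_continuous :
  continuous (@comp_map (vert_groupoid R p BX BY)).
Proof.
move=> x.
have ex : repr (val x).1 one = repr (val x).2 zero by exact: (set_valP x).
rewrite /continuous_at.
have -> : comp_map x = vclass (vconcat ex) by exact: vclass_ext.
move=> W /nbhs_varrow[U [V0 [V2 [[oU +] [oV0 +] [oV2 +] sW]]]].
rewrite /= concat0 concat1 => Uf V0f V2f.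
pose f := repr (val x).1; pose g := repr (val x).2.
have Ug : U (p (f one)) by rewrite vpath_end.
(* V1 is a neighbourhood of the junction f(1) = g(0). Since its loops die in p^-1(U), a square for f
   and a square for g that meet in V1 can be pasted. *)
have [V1 [oV1 V1f tV1]] := Y_llt oU Ug.
have N1 : nbhs ((val x).1 : arrows) (basic_nbhd f U V0 V1).
  rewrite -[(val x).1]vclassK; apply: nbhs_basic_nbhd => //;
  exact: open_nbhs_nbhs.
have N2 : nbhs ((val x).2 : arrows) (basic_nbhd g U V1 V2).
  rewrite -[(val x).2]vclassK; apply: nbhs_basic_nbhd => //;
    apply: open_nbhs_nbhs; split=> //; rewrite /g -ex //.
have c1 : continuous (fun y : composable (vert_groupoid R p BX BY) =>
    (val y).1 : arrows).
  exact: val_comp_continuous (@fst_continuous _ _).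
have c2 : continuous (fun y : composable (vert_groupoid R p BX BY) =>
    (val y).2 : arrows).
  exact: val_comp_continuous (@snd_continuous _ _).
have N : nbhs x ([set y | basic_nbhd f U V0 V1 (val y).1] `&`
    [set y | basic_nbhd g U V1 V2 (val y).2]).
  by apply: (@filterI _ _ (nbhs_filter x));
    [exact: continuous_nbhs c1 N1|exact: continuous_nbhs c2 N2].
apply: (@filterS _ _ (nbhs_filter x) _ _ _ N) => y [].
move=> /basic_nbhdP H1 /basic_nbhdP H2; apply: sW.
have ey : repr (val y).1 one = repr (val y).2 zero by exact: (set_valP y).
have -> : comp_map y = vclass (vconcat ey) by exact: vclass_ext.
have Pi U' (h : vpath R p) t : U' (p (h t)) -> path_in (p @^-1` U') h.
  move=> U'h; split; first exact: vpath_continuous.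
  by move=> s; rewrite /= (vpath_vertical h s t).
have inU (h h' : vpath R p) V V' : square_homotopic (p @^-1` U) V V' h h' ->
    path_in (p @^-1` U) h /\ path_in (p @^-1` U) h'.
  move=> [k [[_ k0 k1] kA _ _]]; split; apply: (Pi _ _ zero).
    by rewrite -k0; exact: kA.
  by rewrite -k1; exact: kA.
have [? ?] := inU _ _ _ _ H1; have [? ?] := inU _ _ _ _ H2.
apply/basic_nbhd_vclass.
exact: square_homotopic_concat tV1 _ _ _ _ ex ey H1 H2.
Qed.

(** In the unit, inverse and associativity laws, [repr_ph] replaces the chosen representative of a
    unit, inverse or composite by the explicit path; the laws for concatenation in a single fibre
    finish the argument. *)
Lemma vert_groupoidP : is_topgroupoid (vert_groupoid R p BX BY).
Proof.
have rp b f := @repr_ph R Y X p b f.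
split=> /=; try by [exact: vsrc_continuous|exact: vtgt_continuous|
  exact: vidm_continuous|exact: vinv_continuous|exact: vcomp_continuous].
- by move=> y; rewrite vsrc_vclass.
- by move=> y; rewrite vtgt_vclass.
- by move=> a; rewrite vsrc_vclass /= rev_unitI0.
- by move=> a; rewrite vtgt_vclass /= rev_unitI1.
- by move=> a b e; rewrite vsrc_vclass /= concat0.
- by move=> a b e; rewrite vtgt_vclass /= concat1.
- move=> a e; set f := repr a.
  have fP := @vpath_in R Y X p _ f erefl.
  have cP := rp (p (f zero)) (vcst R p (f zero)) erefl.
  have ec := (ph_ends cP).1.
  apply: (@vclass_repr_eq R Y X p (p (f zero))); first by rewrite /= concat0 ec.
  apply: ph_trans (ph1m fP); apply: ph_concat => //; exact: ph_refl.
- move=> a e; set f := repr a.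
  have fP := @vpath_in R Y X p _ f erefl.
  have cP := rp (p (f zero)) (vcst R p (f one)) (vpath_end f).
  apply: (@vclass_repr_eq R Y X p (p (f zero))); first by rewrite /= concat0.
  apply: ph_trans (phm1 fP); apply: ph_concat => //; exact: ph_refl.
- move=> a e; set f := repr a.
  have fP := @vpath_in R Y X p _ f erefl.
  have e' : p (vrev f zero) = p (f zero) by rewrite /= rev_unitI0 vpath_end.
  have cP := rp _ (vrev f) e'.
  apply/(@vclass_eqP R Y X p (p (f zero))).
    by rewrite /= concat0 (ph_ends cP).1.
  apply: ph_trans (phVm fP); apply: ph_concat => //; exact: ph_refl.
- move=> a e; set f := repr a.
  have fP := @vpath_in R Y X p _ f erefl.
  have e' : p (vrev f zero) = p (f zero) by rewrite /= rev_unitI0 vpath_end.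
  have cP := rp _ (vrev f) e'.
  apply/(@vclass_eqP R Y X p (p (f zero))); first by rewrite /= concat0.
  apply: ph_trans (phmV fP); apply: ph_concat => //; exact: ph_refl.
- move=> a b c eab ebc e1 e2.
  set f := repr a; set g := repr b; set k := repr c.
  have gf : p (g zero) = p (f zero).
    by rewrite -(vpath_end f); congr p; exact: esym eab.
  have kf : p (k zero) = p (f zero).
    by rewrite -gf -(vpath_end g); congr p; exact: esym ebc.
  pose A := p @^-1` [set p (f zero)].
  have fP := @vpath_in R Y X p _ f erefl.
  have gP := @vpath_in R Y X p _ g gf.
  have kP := @vpath_in R Y X p _ k kf.
  have P1 : ph A (repr (vclass (vconcat eab))) (concat f g).
    by apply: (rp _ (vconcat eab)); rewrite /= concat0.
  have P2 : ph A (repr (vclass (vconcat ebc))) (concat g k).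
    by apply: (rp _ (vconcat ebc)); rewrite /= concat0.
  apply/(@vclass_eqP R Y X p (p (f zero))).
    by rewrite /= concat0 (ph_ends P1).1 concat0.
  apply: (ph_trans (g := concat (concat f g) k)).
    by apply: ph_concat => //; exact: ph_refl.
  apply: ph_trans (phA fP gP kP eab ebc) _.
  by apply: ph_concat; [rewrite concat0|exact: ph_refl|exact: ph_sym].
Qed.

End VerticalTopology.

(** * Weak equivalences from natural transformations *)

Section TotalComposition.

(* The composite of two arrows as a total function, with the junk value [a]
   when [a] and [b] are not composable. *)
Definition tcomp (G : groupoid_data) (a b : ar G) : ar G :=
  if pselect (tgt a = src b) is left e then comp e else a.

Lemma tcompE (G : groupoid_data) (a b : ar G) (e : tgt a = src b) :
  comp e = tcomp a b.
Proof.
by rewrite /tcomp; case: pselect => // e'; congr comp; exact: Prop_irrelevance.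
Qed.

Variable G : topgroupoid.
Implicit Types a b c : ar G.
Let HG := topgroupoidP G.

Lemma src_tcomp a b : tgt a = src b -> src (tcomp a b) = src a.
Proof. by move=> e; rewrite -tcompE (src_comp HG). Qed.

Lemma tgt_tcomp a b : tgt a = src b -> tgt (tcomp a b) = tgt b.
Proof. by move=> e; rewrite -tcompE (tgt_comp HG). Qed.

Lemma tcomp1m a x : src a = x -> tcomp (idm x) a = a.
Proof.
move=> <-; have e : tgt (idm (src a)) = src a by rewrite (tgt_idm HG).
by rewrite -tcompE (comp1m HG).
Qed.

Lemma tcompm1 a x : tgt a = x -> tcomp a (idm x) = a.
Proof.
move=> <-; have e : tgt a = src (idm (tgt a)) by rewrite (src_idm HG).
by rewrite -tcompE (compm1 HG).
Qed.

Lemma tcompVm a : tcomp (inv a) a = idm (tgt a).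
Proof.
have e : tgt (inv a) = src a by rewrite (tgt_inv HG).
by rewrite -tcompE (compVm HG).
Qed.

Lemma tcompmV a : tcomp a (inv a) = idm (src a).
Proof.
have e : tgt a = src (inv a) by rewrite (src_inv HG).
by rewrite -tcompE (compmV HG).
Qed.

Lemma tcompA a b c : tgt a = src b -> tgt b = src c ->
  tcomp (tcomp a b) c = tcomp a (tcomp b c).
Proof.
move=> ab bc; have abc : tgt (tcomp a b) = src c by rewrite tgt_tcomp.
have abc' : tgt a = src (tcomp b c) by rewrite src_tcomp.
rewrite -(tcompE abc) -(tcompE abc'); move: abc abc'.
rewrite -(tcompE ab) -(tcompE bc) => abc abc'; exact: (compA HG).
Qed.

Lemma tcompKV a b : tgt a = src b -> tcomp (inv a) (tcomp a b) = b.
Proof.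
by move=> ab; rewrite -tcompA ?(tgt_inv HG)// tcompVm tcomp1m.
Qed.

Lemma tcomp_lcancel a b c : tgt a = src b -> tgt a = src c ->
  tcomp a b = tcomp a c -> b = c.
Proof. by move=> ab ac abc; rewrite -(tcompKV ab) abc tcompKV. Qed.

Lemma tcomp_continuous (T : topologicalType) (a b : T -> ar G) :
  continuous a -> continuous b -> (forall t, tgt (a t) = src (b t)) ->
  continuous (fun t => tcomp (a t) (b t)).
Proof.
move=> ca cb ab.
pose k (t : T) : composable G := @to_sub _ (composable G) (a t, b t) (ab t).
have -> : (fun t => tcomp (a t) (b t)) = @comp_map G \o k.
  by apply/funext => t; rewrite /= /comp_map tcompE.
apply: comp_continuous (comp_continuous_map HG).
by apply: set_type_continuous; exact: pair_continuous.
Qed.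

End TotalComposition.

(** Only the maps on objects and arrows enter, so composites and identities need no bundling as
    functors. The naturality square is written in diagrammatic order. *)
Definition natural_transformation (D E : topgroupoid)
    (f0 g0 : ob D -> ob E) (f1 g1 : ar D -> ar E) (K : ob D -> ar E) :=
  [/\ continuous K, forall x, src (K x) = f0 x, forall x, tgt (K x) = g0 x &
      forall a, tcomp (f1 a) (K (tgt a)) = tcomp (K (src a)) (g1 a)].

(** * Functors inverse up to natural transformation *)

Section NaturalEquivalence.
Variables (D E : topgroupoid) (f : functor D E) (g : functor E D).
Variables (K : ob D -> ar D) (H : ob E -> ar E).
Hypothesis K_natural : natural_transformation (fob g \o fob f) idfun
  (far g \o far f) idfun K.
Hypothesis H_natural : natural_transformation (fob f \o fob g) idfun
  (far f \o far g) idfun H.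

Let HD := topgroupoidP D.
Let Hf := functorP f.
Let Hg := functorP g.

(** Naturality gives f(g b) * H = H * b, so b is recovered from g b and its ends by cancelling H on
    the left. *)
Let far_g_inj b b' : src b = src b' -> tgt b = tgt b' -> far g b = far g b' ->
  b = b'.
Proof.
move=> s t gbb; have [_ H0 H1 HN] := H_natural.
apply: (@tcomp_lcancel E (H (src b))); [exact: H1|by rewrite s; exact: H1|].
have HNE c : tcomp (far f (far g c)) (H (tgt c)) = tcomp (H (src c)) c.
  exact: HN.
by rewrite -HNE s -HNE t gbb.
Qed.

Let pre (z : hom_pullback f) : ar D :=
  tcomp (inv (K (val z).1.1)) (tcomp (far g (val z).2) (K (val z).1.2)).

Let e1 (z : hom_pullback f) : tgt (far g (val z).2) = src (K (val z).1.2).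
Proof.
have [_ zt] := set_valP z; have [_ K0 _ _] := K_natural.
by rewrite (f1_tgt Hg) K0 /= -zt.
Qed.

Let e2 (z : hom_pullback f) :
  tgt (inv (K (val z).1.1)) = src (tcomp (far g (val z).2) (K (val z).1.2)).
Proof.
have [zs _] := set_valP z; have [_ K0 _ _] := K_natural.
by rewrite (tgt_inv HD) src_tcomp ?e1// K0 (f1_src Hg) /= -zs.
Qed.

(* The arrow over [b] is [K^-1 * g b * K]; it is mapped to [b] because their
   images under [g] agree and [g] is faithful by naturality of [H]. *)
Lemma natural_weak_equivalence : weak_equivalence f.
Proof.
have [cK K0 K1 KN] := K_natural; have [cH H0 H1 HN] := H_natural.
split; last first.
  (* The arrow H y goes from f(g y) to y, so y |-> (g y, H y) is a global section. *)
  move=> y; exists setT; split=> //; first exact: openT.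
  have P (x : [set: ob E]) : target_pullback f (fob g (val x), H (val x)).
    by rewrite /target_pullback /= H0.
  exists (fun x => to_sub (P x)); split; last by move=> x; exact: H1.
  apply: set_type_continuous; apply: pair_continuous.
    exact: val_comp_continuous (f0_continuous Hg).
  exact: val_comp_continuous cH.
split.
  apply: set_type_continuous; apply: pair_continuous.
    exact: pair_continuous (src_continuous HD) (tgt_continuous HD).
  exact: f1_continuous Hf.
exists pre; split.
- have cx : continuous (fun z : hom_pullback f => (val z).1.1).
    apply: (@val_comp_continuous _ _ (hom_pullback f) (fun z => z.1.1)).
    exact: comp_continuous (@fst_continuous _ _) (@fst_continuous _ _).
  have cy : continuous (fun z : hom_pullback f => (val z).1.2).
    apply: (@val_comp_continuous _ _ (hom_pullback f) (fun z => z.1.2)).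
    exact: comp_continuous (@fst_continuous _ _) (@snd_continuous _ _).
  have cb : continuous (fun z : hom_pullback f => (val z).2).
    exact: val_comp_continuous (@snd_continuous _ _).
  apply: tcomp_continuous e2.
    exact: (comp_continuous (comp_continuous cx cK) (inv_continuous HD)).
  apply: tcomp_continuous e1; last exact: comp_continuous cy cK.
  exact: comp_continuous cb (f1_continuous Hg).
- move=> a; rewrite /pre /=; have /= -> := KN a.
  by rewrite tcompKV // K1.
- move=> z; have [zs zt] := set_valP z.
  have s : src (pre z) = (val z).1.1.
    by rewrite /pre src_tcomp ?e2// (src_inv HD) K1.
  have t : tgt (pre z) = (val z).1.2.
    by rewrite /pre tgt_tcomp ?e2// tgt_tcomp ?e1// K1.
  apply: val_inj; rewrite /= s t -surjective_pairing.
  rewrite [RHS]surjective_pairing; congr pair.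
  apply: far_g_inj; first by rewrite (f1_src Hf) s zs.
    by rewrite (f1_tgt Hf) t zt.
  (* With b the arrow component of z, naturality at [pre z] gives g(f(pre z)) * K = K * pre z = g b
     * K, and K is cancelled on the right. *)
  have KNz := KN (pre z); rewrite /= s t in KNz.
  have e3 : tgt (far g (far f (pre z))) = src (K (val z).1.2).
    by rewrite (f1_tgt Hg) (f1_tgt Hf) t K0.
  have KzV : tcomp (K (val z).1.1) (pre z) =
      tcomp (far g (val z).2) (K (val z).1.2).
    rewrite /pre -tcompA ?(src_inv HD) ?e2// tcompmV tcomp1m //.
    by rewrite src_tcomp ?e1// (f1_src Hg) zs K0.
  rewrite -[LHS](tcompm1 e3) -tcompmV -tcompA ?(src_inv HD)// KNz KzV.
  by rewrite tcompA ?e1 ?(src_inv HD)// tcompmV tcompm1 ?e1.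
Qed.

End NaturalEquivalence.

Lemma id_functorP (D : topgroupoid) : is_functor (@id (ob D)) (@id (ar D)).
Proof.
split=> //; try by move=> x; exact: cvg_id.
by move=> a b e e'; congr comp; exact: Prop_irrelevance.
Qed.

Definition id_functor (D : topgroupoid) : functor D D :=
  Functor (id_functorP D).

(** The identity is its own inverse, with the unit arrows as both natural transformations. *)
Lemma id_weak_equivalence (D : topgroupoid) : weak_equivalence (id_functor D).
Proof.
have HD := topgroupoidP D.
pose i := id_functor D.
have N : natural_transformation (fob i \o fob i) idfun (far i \o far i) idfun
    (@idm D).
  split; [exact: (idm_continuous HD)|exact: (src_idm HD)|exact: (tgt_idm HD)|].
  by move=> a /=; rewrite tcompm1 // tcomp1m.
exact: (natural_weak_equivalence N N).
Qed.

(** * Local triviality of loops *)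

Section Subspaces.
Variable R : realType.
Local Notation I := (unitI R).

Lemma nbhs_subspaceP (T : topologicalType) (A : set T) (x : A) (W : set A) :
  nbhs x W -> exists O, [/\ open O, O (val x) & forall y : A, O (val y) -> W y].
Proof.
rewrite nbhsE => -[O' [[O oO <-] Ox] OW]; exists O; split=> // y Oy; exact: OW.
Qed.

Lemma nbhs_sub_image (T : topologicalType) (A : set T) (x : A) (W : set A) :
  open A -> nbhs x W -> nbhs (val x) [set y | exists h : A y, W (to_sub h)].
Proof.
move=> oA /nbhs_subspaceP[O [oO Ox OW]].
apply: (@filterS _ _ (nbhs_filter (val x)) (O `&` A)).
  by move=> y [Oy Ay]; exists Ay; exact: OW.
apply: open_nbhs_nbhs; split; first exact: openI.
by split=> //; exact: set_valP.
Qed.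

Lemma to_sub_val (T : Type) (A : set T) (x : A) (h : A (val x)) : to_sub h = x.
Proof. exact: val_inj. Qed.

Lemma locally_path_connected_sub (T : topologicalType) (A : set T) :
  open A -> locally_path_connected R T -> locally_path_connected R A.
Proof.
move=> oA lT x W xW.
have [V [oV Vx VW pV]] := lT _ _ (nbhs_sub_image oA xW).
have VA y : V y -> A y by move=> /VW[].
exists (val @^-1` V); split=> //.
- by apply: open_comp => // y _; exact: val_continuous.
- by move=> y /VW[h]; rewrite to_sub_val.
- move=> y z Vy Vz; have [gam Vgam] := pV _ _ Vy Vz.
  pose g t : A := to_sub (VA _ (Vgam t)).
  have cg : continuous g by apply: set_type_continuous; exact: cts_fun.
  have g0 : g zero = y by apply: val_inj; exact: path_zero.
  have g1 : g one = z by apply: val_inj; exact: path_one.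
  by exists (mk_path cg g0 g1).
Qed.

Lemma locally_path_connected_prod (S T : topologicalType) :
  locally_path_connected R S -> locally_path_connected R T ->
  locally_path_connected R (S * T)%type.
Proof.
move=> lS lT [x y] W [[W1 W2] /= [xW1 yW2] WW].
have [V1 [oV1 V1x VW1 pV1]] := lS _ _ xW1.
have [V2 [oV2 V2y VW2 pV2]] := lT _ _ yW2.
exists (V1 `*` V2); split=> //.
- rewrite openE => z [z1 z2]; exists (V1, V2) => //.
  by split; exact: open_nbhs_nbhs.
- by move=> z [/VW1 ? /VW2 ?]; exact: WW.
- move=> [x1 y1] [x2 y2] [/= ? ?] [/= ? ?].
  have [g Vg] := pV1 x1 x2 ltac:(by []) ltac:(by []).
  have [h Vh] := pV2 y1 y2 ltac:(by []) ltac:(by []).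
  have cg : continuous g by exact: cts_fun.
  have ch : continuous h by exact: cts_fun.
  have c := pair_continuous cg ch.
  have e0 : (g zero, h zero) = (x1, y1).
    by congr pair; exact: path_zero.
  have e1 : (g one, h one) = (x2, y2).
    by congr pair; exact: path_one.
  by exists (mk_path c e0 e1) => t; split; [exact: Vg|exact: Vh].
Qed.

Lemma pi1_trivial_loops (X : topologicalType) (V A : set X) :
  pi1_trivial_in R V A -> loops_trivial_in R V A.
Proof.
by move=> VA f [cf Vf] f01; exact: (VA _ (mk_path cf erefl (esym f01)) Vf).
Qed.

(** Let k be the trace of the base point and g the final loop. The square gives k * g ~ h(0,-) * k ~
    k, whence g ~ k^-1 * k * g ~ k^-1 * k is trivial. *)
Lemma ph_free_homotopy (X : topologicalType) (A : set X) (h : I * I -> X) :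
  continuous h -> (forall z, A (h z)) ->
  (forall t, h (t, zero) = h (t, one)) ->
  path_homotopic_in A (fun s => h (zero, s)) (cst (h (zero, zero))) ->
  path_homotopic_in A (fun s => h (one, s)) (cst (h (one, zero))).
Proof.
move=> ch hA h01 h0.
pose k t := h (t, zero); pose g s := h (one, s).
have kP : path_in A k.
  by split=> [|t]; [exact: column_continuous|exact: hA].
have gP : path_in A g.
  by split=> [|t]; [exact: row_continuous|exact: hA].
have kg : k one = g zero by [].
have ek : (k \o @rev_unitI R) one = k zero by rewrite /= rev_unitI1.
have kV := path_in_rev kP.
have sq : path_homotopic_in A (concat k g) k.
  apply: ph_trans (ph1m kP).
  apply: ph_trans (ph_sym (ph_square ch hA)) _.
  have -> : (fun t => h (t, one)) = k by apply/funext => t; rewrite -h01.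
  by apply: ph_concat; [exact: esym (h01 zero)|exact: h0|exact: ph_refl].
apply: (ph_trans (ph_sym (ph1m gP))).
apply: (ph_trans (g := concat (concat (k \o @rev_unitI R) k) g)).
  apply: ph_concat => //; last exact: ph_refl.
  exact: ph_sym (phVm kP).
apply: ph_trans (phA kV kP gP ek kg) _.
apply: ph_trans (phVm kP); apply: ph_concat => //; last exact: ph_refl.
by rewrite concat0.
Qed.

Lemma ph_map (X Y : topologicalType) (A : set X) (A' : set Y) (m : X -> Y)
    (f g : I -> X) :
  continuous m -> (forall x, A x -> A' (m x)) ->
  path_homotopic_in A f g -> path_homotopic_in A' (m \o f) (m \o g).
Proof.
move=> cm mA [h [[ch h0 h1] hr hA]]; exists (m \o h); split.
- split; first exact: comp_continuous ch cm.
  + by move=> s /=; rewrite h0.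
  + by move=> s /=; rewrite h1.
- by move=> t /=; rewrite (hr t).1 (hr t).2.
- by move=> z; exact: mA.
Qed.

Lemma ph_lift (X : topologicalType) (S A : set X) (f g : I -> S) :
  A `<=` S -> path_homotopic_in A (val \o f) (val \o g) ->
  @path_homotopic_in R S (val @^-1` A) f g.
Proof.
move=> AS [h [[ch h0 h1] hr hA]].
exists (fun z => to_sub (AS _ (hA z))); split=> //.
- split; first exact: set_type_continuous.
  + by move=> s; apply: val_inj; rewrite /= h0.
  + by move=> s; apply: val_inj; rewrite /= h1.
- by move=> t; split; apply: val_inj; rewrite /= ?(hr t).1 ?(hr t).2.
Qed.

Lemma ph_pair (X Y : topologicalType) (A : set X) (A' : set Y)
    (f g : I -> X) (f' g' : I -> Y) :
  path_homotopic_in A f g -> path_homotopic_in A' f' g' ->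
  path_homotopic_in (A `*` A') (fun t => (f t, f' t)) (fun t => (g t, g' t)).
Proof.
move=> [h [[ch h0 h1] hr hA]] [k [[ck k0 k1] kr kA]].
exists (fun z => (h z, k z)); split.
- split; first exact: pair_continuous.
  + by move=> s; rewrite h0 k0.
  + by move=> s; rewrite h1 k1.
- by move=> t; rewrite (hr t).1 (hr t).2 (kr t).1 (kr t).2.
- by move=> z; split; [exact: hA|exact: kA].
Qed.

End Subspaces.

(** * Small loops in the fibre and in the total space *)

Section LocalLoops.
Variables (R : realType).
Local Notation I := (unitI R).

(** Since x lies in U, the preimage of U is all of F, and contractibility of small loops in F is
    enough. *)
Lemma point_locally_loop_trivial (F X : topologicalType) (x : X) :
  semilocally_1connected R F ->
  locally_loop_trivial R (fun _ : F => x).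
Proof.
move=> sF y U _ Ux.
have [V [oV Vy _ [_ tV]]] := sF y setT (@filterT _ _ (nbhs_filter y)).
exists V; split=> // f Vf f01.
by apply: phS (pi1_trivial_loops tV Vf f01) => z _.
Qed.

Lemma semilocally_locally_path_connected (F : topologicalType) :
  semilocally_1connected R F -> locally_path_connected R F.
Proof.
by move=> sF x U /sF[V [oV Vx VU [pV _]]]; exists V.
Qed.

Lemma locally_1connected_path_connected (B : topologicalType) :
  locally_1connected R B -> locally_path_connected R B.
Proof.
by move=> lB x U /lB[V [oV Vx VU [pV _]]]; exists V.
Qed.

(** For a small loop f, the base component of phi f contracts in a 1-connected U' and the fibre
    component contracts in F. Hence psi phi f contracts over U'. The vertical homotopy K is a free
    homotopy from psi phi f to f over U', so f contracts there too. *)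
Lemma fibration_locally_loop_trivial (B E F : topologicalType) (p : E -> B) :
  locally_1connected R B -> semilocally_1connected R F ->
  locally_homotopy_trivial_fibration R F p -> locally_loop_trivial R p.
Proof.
move=> lB sF [[cp _] [C [Co CT Ctriv]]] y U0 oU0 U0y.
have [U CU Uy] : (\bigcup_(U in C) U) (p y) by rewrite CT.
have oU := Co _ CU.
have [phi [psi [[cphi cpsi phiq psiq] [_ [K [[cK K0 K1] Kq]]]]]] := Ctriv _ CU.
have [U' [oU' U'y UU' [_ tU']]] := lB (p y) (U0 `&` U)
  (open_nbhs_nbhs (conj (openI oU0 oU) (conj U0y Uy))).
have U'U x : U' x -> U x by move=> /UU'[].
pose ys : p @^-1` U := @to_sub _ (p @^-1` U) y Uy.
have [W [oW Wy _ [_ tW]]] :=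
  sF (phi ys).2 setT (@filterT _ _ (nbhs_filter _)).
have c2 : continuous (fun e => (phi e).2).
  exact: comp_continuous cphi (@snd_continuous _ _).
(* O is open in E, and its points over U have fibre coordinate in W. *)
have [O [oO Oy OW]] := nbhs_subspaceP
  (c2 ys W (open_nbhs_nbhs (conj oW Wy))).
exists (O `&` p @^-1` U'); split=> //.
  by apply: openI => //; apply: open_comp => // x _; exact: cp.
move=> f [cf Vf] f01.
pose fs t : p @^-1` U := @to_sub _ (p @^-1` U) (f t) (U'U _ (Vf t).2).
have cfs : continuous fs by exact: set_type_continuous.
have fs01 : fs zero = fs one by apply: val_inj.
have phiE e : val (phi e).1 = p (val e) by exact: (congr1 (@^~ e) phiq).
have psiE z : p (val (psi z)) = val z.1 by exact: (congr1 (@^~ z) psiq).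
have KE t e : p (val (K (t, e))) = p (val e).
  by rewrite (Kq t e) K0 /= psiE phiE.
pose g t := phi (fs t).
have cg : continuous g by exact: comp_continuous cfs cphi.
have gB : @path_homotopic_in R U (val @^-1` U') (fst \o g) (cst (g zero).1).
  apply: ph_lift => //.
  have -> : val \o (fst \o g) = p \o f by apply/funext => t /=; rewrite phiE.
  have -> : val \o (cst (g zero).1 : I -> U) = cst (p (f zero)).
    by apply/funext => t /=; rewrite phiE.
  apply: (pi1_trivial_loops tU' (f := p \o f)); last by rewrite /= f01.
  by split=> [|t]; [exact: comp_continuous cf cp|have [] := Vf t].
have gF : path_homotopic_in setT (snd \o g) (cst (g zero).2).
  apply: (pi1_trivial_loops tW (f := snd \o g)); last by rewrite /= /g fs01.
  split=> [|t]; first exact: comp_continuous cg (@snd_continuous _ _).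
  by apply: OW; have [] := Vf t.
have AU' : p @^-1` U' `<=` p @^-1` U0 by move=> x /UU'[].
apply: phS AU' _.
(* Each stage is a loop because fs(0) = fs(1), but the base point moves; hence the appeal to
   [ph_free_homotopy]. *)
pose h (z : I * I) := val (K (z.1, fs z.2)).
have h1 : (fun s => h (one, s)) = f by apply/funext => s; rewrite /h /= K1.
have <- : h (one, zero) = f zero by rewrite -h1.
rewrite -{1}h1; apply: ph_free_homotopy.
- have cs : continuous (fun z : I * I => (z.1, fs z.2)).
    apply: pair_continuous; first exact: fst_continuous.
    exact: comp_continuous (@snd_continuous _ _) cfs.
  exact: (comp_continuous (comp_continuous cs cK) (@val_continuous _ _)).
- by move=> z; rewrite /h /= KE; have [] := Vf z.2.
- by move=> t; rewrite /h /= fs01.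
pose m z : E := val (psi z).
have hm s : h (zero, s) = m ((g s).1, (g s).2).
  by rewrite /h /m /= K0 -surjective_pairing.
have -> : (fun s => h (zero, s)) = m \o (fun t => ((g t).1, (g t).2)).
  exact/funext.
rewrite hm.
apply: (@ph_map R _ _ _ _ m _ (fun=> ((g zero).1, (g zero).2)) _ _
  (ph_pair gB gF)).
  exact: comp_continuous cpsi (@val_continuous _ _).
by move=> z [zU _]; rewrite /= psiE.
Qed.

End LocalLoops.

(** * Local trivialisation *)

Lemma swap_continuous (S T : topologicalType) :
  continuous (fun z : S * T => (z.2, z.1)).
Proof. exact: pair_continuous (@snd_continuous _ _) (@fst_continuous _ _). Qed.

Section Trivialisation.
Variables (R : realType) (B E F : topologicalType) (p : E -> B).
Variables (BB : open_basis B) (BE : open_basis E) (BF : open_basis F).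
Local Notation I := (unitI R).
Local Notation ph := path_homotopic_in.
Local Notation pt := (fun _ : F => tt : discrete_topology unit).

Hypothesis HZ : is_topgroupoid (vert_groupoid R p BB BE).
Hypothesis Hq : is_functor (D := vert_groupoid R p BB BE) (E := disc B)
  p (@vert_proj R E B p).
Hypothesis HG : is_topgroupoid (fund_groupoid R BF).
Hypothesis p_continuous : continuous p.
Hypothesis B_lpc : locally_path_connected R B.
Hypothesis E_lpc : locally_path_connected R E.
Hypothesis F_lpc : locally_path_connected R F.

Variable U : set B.
Hypothesis U_open : open U.
Local Notation S := (p @^-1` U).
Variables (phi : S -> U * F) (psi : U * F -> S).
Variables (K : I * S -> S) (H : I * (U * F) -> U * F).
Hypothesis phi_continuous : continuous phi.
Hypothesis psi_continuous : continuous psi.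
Hypothesis phiE : forall e : S, val (phi e).1 = p (val e).
Hypothesis psiE : forall z, p (val (psi z)) = val z.1.
Hypothesis K_homotopy : homotopy K (psi \o phi) idfun.
Hypothesis H_homotopy : homotopy H (phi \o psi) idfun.
Hypothesis KE : forall t e, p (val (K (t, e))) = p (val e).

Let ZU := restr (Z := TopGroupoid HZ) (Functor Hq) U.
Let GU := prod_groupoid (TopGroupoid HG) U.

Definition point_vpath (f : I -> F) (cf : continuous f) : vpath R pt :=
  @VPath R F _ pt f cf (fun _ _ => erefl).

Lemma point_vclassP (f g : vpath R pt) : vclass f = vclass g <-> ph setT f g.
Proof.
rewrite (@vclass_eqP R F _ pt tt) //.
by split; apply: phS => // z _; case: (pt z).
Qed.

(** * The maps on arrows induced by phi and psi *)

Definition corestrict (f : I -> E) (Uf : forall t, U (p (f t))) (t : I) : S :=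
  @to_sub _ S (f t) (Uf t).

Lemma corestrict_continuous f (Uf : forall t, U (p (f t))) :
  continuous f -> continuous (corestrict Uf).
Proof. by move=> cf; exact: set_type_continuous. Qed.

Lemma arrow_over (a : ar ZU) t : U (p (repr (val a) t)).
Proof. by rewrite (vpath_vertical _ t zero); exact: (set_valP a). Qed.

Lemma phi2_continuous : continuous (fun e => (phi e).2).
Proof. exact: comp_continuous phi_continuous (@snd_continuous _ _). Qed.

(** Only the fibre component of phi along f is kept: the base component is constant because f is
    vertical, and [phi_ar] records it separately. *)
Definition phi_path (f : vpath R p) (Uf : forall t, U (p (f t))) : vpath R pt :=
  point_vpath (comp_continuous
    (corestrict_continuous (Uf := Uf) (@vpath_continuous _ _ _ _ f))
    phi2_continuous).

Lemma phi_path_vclass (f f' : vpath R p) (Uf : forall t, U (p (f t)))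
    (Uf' : forall t, U (p (f' t))) :
  vclass f = vclass f' -> vclass (phi_path Uf) = vclass (phi_path Uf').
Proof.
move=> /(@vclass_eqP R E B p (p (f zero)) _ _ erefl) ff'.
apply/point_vclassP.
have AS : p @^-1` [set p (f zero)] `<=` S by move=> e /= ->; exact: Uf.
have := @ph_lift R _ _ _ (corestrict Uf) (corestrict Uf') AS ff'.
exact: ph_map phi2_continuous _.
Qed.

Lemma psi_path_vertical (f : vpath R pt) (u : U) (s t : I) :
  p (val (psi (u, f s))) = p (val (psi (u, f t))).
Proof. by rewrite !psiE. Qed.

Lemma psi_row_continuous (u : U) : continuous (fun y => val (psi (u, y)) : E).
Proof.
exact: comp_continuous (row_continuous (s := u) psi_continuous)
  (@val_continuous _ _).
Qed.

Definition psi_path (f : vpath R pt) (u : U) : vpath R p :=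
  VPath (comp_continuous (@vpath_continuous _ _ _ _ f) (@psi_row_continuous u))
    (psi_path_vertical f u).

Lemma psi_path_vclass f f' u :
  vclass f = vclass f' -> vclass (psi_path f u) = vclass (psi_path f' u).
Proof.
move=> /point_vclassP ff'; apply/(@vclass_eqP R E B p (val u)).
  by rewrite /= psiE.
by apply: ph_map (@psi_row_continuous u) _ ff' => y _ /=; rewrite psiE.
Qed.

Lemma psi_path_over f u : (@vert_proj R E B p @^-1` U) (vclass (psi_path f u)).
Proof. by rewrite /vert_proj /= vsrc_vclass /= psiE; exact: set_valP. Qed.

Definition phi_ob (e : ob ZU) : ob GU := ((phi e).2, (phi e).1).
Definition phi_ar (a : ar ZU) : ar GU :=
  (vclass (phi_path (arrow_over a)), (phi (corestrict (arrow_over a) zero)).1).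
Definition psi_ob (z : ob GU) : ob ZU := psi (z.2, z.1).
Definition psi_ar (b : ar GU) : ar ZU :=
  to_sub (psi_path_over (repr b.1) b.2).

(** Although [phi_ar] is defined through a chosen representative, it may be computed on any other;
    likewise [psi_arE]. *)
Lemma phi_arE (a : ar ZU) (f : vpath R p) (Uf : forall t, U (p (f t))) :
  val a = vclass f -> (phi_ar a).1 = vclass (phi_path Uf).
Proof. by move=> af; apply: phi_path_vclass; rewrite vclassK. Qed.

Lemma psi_arE (b : ar GU) f : b.1 = vclass f ->
  val (psi_ar b) = vclass (psi_path f b.2).
Proof. by move=> bf; apply: psi_path_vclass; rewrite vclassK. Qed.

Lemma src_restr (a : ar ZU) : corestrict (arrow_over a) zero = src a.
Proof. exact: val_inj. Qed.

Lemma tgt_restr (a : ar ZU) : corestrict (arrow_over a) one = tgt a.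
Proof. exact: val_inj. Qed.

Lemma phi_ar2 (a : ar ZU) t :
  (phi_ar a).2 = (phi (corestrict (arrow_over a) t)).1.
Proof. by apply: val_inj; rewrite /= !phiE /=; exact: vpath_vertical. Qed.

Lemma val_tcomp_restr (a b : ar ZU) (f g : vpath R p) (e : f one = g zero) :
  tgt a = src b -> val a = vclass f -> val b = vclass g ->
  val (tcomp a b) = vclass (vconcat e).
Proof.
move=> ab af bg; rewrite -tcompE /=.
move: (congr1 val ab) => /=; rewrite af bg => e'; exact: vcomp_vclass.
Qed.

Lemma tcomp_prod1 (a b : ar GU) (f g : vpath R pt) (e : f one = g zero) :
  tgt a = src b -> a.1 = vclass f -> b.1 = vclass g ->
  (tcomp a b).1 = vclass (vconcat e).
Proof.
move=> ab af bg; rewrite -tcompE /=.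
move: (congr1 fst ab) => /=; rewrite af bg => e'; exact: vcomp_vclass.
Qed.

Lemma tcomp_prod2 (a b : ar GU) : (tcomp a b).2 = a.2.
Proof. by rewrite /tcomp; case: pselect. Qed.

(** The second component of phi carries a homotopy in p^-1(U), vertical or not, to a homotopy in
    F. *)
Lemma phi_ar_continuous : continuous phi_ar.
Proof.
have HZU := topgroupoidP ZU.
apply: pair_continuous; last first.
  have -> : (fun a : ar ZU => (phi (corestrict (arrow_over a) zero)).1) =
      (fun e : S => (phi e).1) \o @src ZU.
    by apply/funext => a; rewrite src_restr.
  apply: (comp_continuous (src_continuous HZU)).
  exact: comp_continuous phi_continuous (@fst_continuous _ _).
move=> a W /nbhs_varrow[U1 [V0 [V1 [[_ U1f] [oV0 V0f] [oV1 V1f] sW]]]].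
(* The points of E over U with fibre coordinate in V. As p^-1(U) is open, these form neighbourhoods
   in E and not only in the subspace. *)
pose img V := [set y | exists h : S y, V (phi (to_sub h)).2].
have S_open : open S by apply: open_comp => // y _; exact: p_continuous.
have imgN V t : open V -> V (phi (corestrict (arrow_over a) t)).2 ->
    nbhs (repr (val a) t) (img V).
  move=> oV Vt.
  have Nt : nbhs (corestrict (arrow_over a) t) [set e | V (phi e).2].
    exact: (phi2_continuous (open_nbhs_nbhs (conj oV Vt))).
  exact: nbhs_sub_image S_open Nt.
(* The base set U keeps the homotopies inside the domain of phi. *)
have N : nbhs (vclass (repr (val a)) : varrow_space R p BB BE)
    (basic_nbhd (repr (val a)) U (img V0) (img V1)).
  apply: nbhs_basic_nbhd.
  - by apply: open_nbhs_nbhs; split=> //; exact: arrow_over.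
  - exact: imgN.
  - exact: imgN.
rewrite vclassK in N.
have := continuous_nbhs (@val_continuous _ (far (Functor Hq) @^-1` U)) N.
apply: (@filterS _ _ (nbhs_filter a)) => c.
move=> /basic_nbhdP[h [[ch h0 h1] hU hV0 hV1]].
apply: sW; apply/basic_nbhd_vclass.
exists (fun z => (phi (@to_sub _ S (h z) (hU z))).2); split=> //.
- split.
  + apply: (comp_continuous (f := fun z => @to_sub _ S (h z) (hU z)) _
      phi2_continuous).
    exact: set_type_continuous.
  + by move=> s; congr (phi _).2; apply: val_inj; exact: h0.
  + by move=> s; congr (phi _).2; apply: val_inj; exact: h1.
- by move=> t; have [hh] := hV0 t; congr (V0 (phi _).2); exact: val_inj.
- by move=> t; have [hh] := hV1 t; congr (V1 (phi _).2); exact: val_inj.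
Qed.

Lemma phi_functorP : is_functor phi_ob phi_ar.
Proof.
split; last 5 first.
- exact: phi_ar_continuous.
- by move=> a; congr pair; rewrite /= ?vsrc_vclass /= src_restr.
- move=> a; congr pair.
    by apply: etrans (vtgt_vclass _) _; rewrite -tgt_restr.
  by rewrite -[LHS]/((phi_ar a).2) (phi_ar2 a one) tgt_restr.
- move=> x; rewrite [LHS]surjective_pairing; congr pair.
    have Ux t : U (p (vcst R p (val x) t)) by exact: (set_valP x).
    rewrite (phi_arE Ux) //; apply: vclass_ext => t.
    by congr (phi _).2; exact: val_inj.
  by apply: val_inj; rewrite /= !phiE; congr p; exact: vsrc_vclass.
- move=> a b e e'; rewrite (tcompE e') [LHS]surjective_pairing.
  rewrite [RHS]surjective_pairing tcomp_prod2; congr pair; last first.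
    apply: val_inj; rewrite /= !phiE; congr p.
    by apply: etrans (vsrc_vclass _) _; rewrite /= concat0.
  have e1 : repr (val a) one = repr (val b) zero by exact: (congr1 val e).
  have e2 : (phi_path (arrow_over a)) one = (phi_path (arrow_over b)) zero.
    by rewrite /= tgt_restr src_restr e.
  rewrite (tcomp_prod1 (a := phi_ar a) (b := phi_ar b) e2) //.
  have Uc t : U (p (vconcat e1 t)).
    by rewrite /= /concat; case: ifP => _; exact: arrow_over.
  rewrite (phi_arE Uc); last exact: vclass_ext.
  apply: vclass_ext => t; rewrite /= /concat; case: ifP => tt2;
    by congr (phi _).2; apply: val_inj; rewrite /= /concat tt2.
apply: pair_continuous; first exact: phi2_continuous.
exact: comp_continuous phi_continuous (@fst_continuous _ _).
Qed.

(** A basic neighbourhood demands an actual homotopy, so passing from u to u' must be realised by a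
    path [gam] in U. This is where local path-connectedness of B enters; psi(gam, h) then combines
    the movements in base and fibre. *)
Lemma psi_ar_continuous : continuous psi_ar.
Proof.
apply: set_type_continuous => -[al u] W.
move=> /nbhs_varrow[U1 [V0 [V1 [[oU1 U1f] [oV0 V0f] [oV1 V1f] sW]]]].
have box V y : open V -> V (val (psi (u, y))) -> exists A W0,
    [/\ nbhs u A, nbhs y W0 &
        forall u' y', A u' -> W0 y' -> V (val (psi (u', y')))].
  move=> oV Vy; have : nbhs (u, y) [set z | V (val (psi z))].
    exact: (comp_continuous psi_continuous (@val_continuous _ _)
      (open_nbhs_nbhs (conj oV Vy))).
  move=> [[A W0] /= [Au W0y] AW]; exists A, W0; split=> // u' y' Au' W0y'.
  exact: (AW (u', y')).
have [A0 [W0 [A0u W0y AW0]]] := box _ _ oV0 V0f.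
have [A1 [W1 [A1u W1y AW1]]] := box _ _ oV1 V1f.
have A2u : nbhs u (val @^-1` U1 : set U).
  apply: (@val_continuous _ U); apply: open_nbhs_nbhs; split=> //.
  by have := U1f; rewrite /= psiE.
(* The path-connected A meets three demands: its points lie in U1, and together with fibre points in
   W0 or W1 they are sent by psi into V0 or V1. *)
have [A [oA Au AS Apc]] := locally_path_connected_sub U_open B_lpc
  (filterI A2u (filterI A0u A1u)).
have N : nbhs (vclass (repr al) : ar (fund_groupoid R BF))
    (basic_nbhd (repr al) setT W0 W1).
  by apply: nbhs_basic_nbhd => //; exact: filterT.
rewrite vclassK in N.
exists (basic_nbhd (repr al) setT W0 W1, A).
  by split=> //; exact: open_nbhs_nbhs.
move=> [al' u'] [/basic_nbhdP[h [[ch h0 h1] _ hW0 hW1]] Au'].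
have [gam Agam] := Apc _ _ Au Au'.
have cgam : continuous gam by exact: cts_fun.
have g0 : gam zero = u by exact: path_zero.
have g1 : gam one = u' by exact: path_one.
apply: sW; apply/basic_nbhd_vclass.
exists (fun z => val (psi (gam z.1, h z))); split.
- split.
  + have c : continuous (fun z : I * I => (gam z.1, h z)).
      apply: pair_continuous ch.
      exact: comp_continuous (@fst_continuous _ _) cgam.
    exact: comp_continuous (comp_continuous c psi_continuous)
      (@val_continuous _ _).
  + by move=> s; rewrite /= g0 h0.
  + by move=> s; rewrite /= g1 h1.
- by move=> z; rewrite psiE; have [] := AS _ (Agam z.1).
- by move=> t; apply: AW0 => //; have [_ []] := AS _ (Agam t).
- by move=> t; apply: AW1 => //; have [_ []] := AS _ (Agam t).
Qed.

Lemma psi_functorP : is_functor psi_ob psi_ar.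
Proof.
split; last 5 first.
- exact: psi_ar_continuous.
- by move=> a; apply: val_inj; rewrite /= vsrc_vclass.
- by move=> a; apply: val_inj; rewrite /= vtgt_vclass.
- move=> x; apply: val_inj; rewrite (psi_arE (f := vcst R pt x.1)) //.
  exact: vclass_ext.
- move=> a b e e'; apply: val_inj; rewrite (tcompE e').
  have e1 : repr a.1 one = repr b.1 zero by exact: (congr1 fst e).
  have e2 : psi_path (repr a.1) a.2 one = psi_path (repr b.1) b.2 zero.
    by rewrite /= e1 (congr1 snd e : a.2 = b.2).
  rewrite (val_tcomp_restr (f := psi_path (repr a.1) a.2)
    (g := psi_path (repr b.1) b.2) e2) //.
  rewrite (psi_arE (f := vconcat e1)); last exact: vclass_ext.
  apply: vclass_ext => t.
  by rewrite /= /concat; case: ifP; rewrite // (congr1 snd e : a.2 = b.2).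
exact: comp_continuous (@swap_continuous F U) psi_continuous.
Qed.

Definition phi_functor : functor ZU GU := Functor phi_functorP.
Definition psi_functor : functor GU ZU := Functor psi_functorP.

(** * The natural transformations given by the homotopies *)

Lemma K_path_vertical (x : S) (s t : I) :
  p (val (K (s, x))) = p (val (K (t, x))).
Proof. by rewrite !KE. Qed.

Let cK : continuous K. Proof. by case: K_homotopy. Qed.
Let K0 x : K (zero, x) = psi (phi x). Proof. by case: K_homotopy. Qed.
Let K1 x : K (one, x) = x. Proof. by case: K_homotopy. Qed.
Let cH : continuous H. Proof. by case: H_homotopy. Qed.
Let H0 x : H (zero, x) = phi (psi x). Proof. by case: H_homotopy. Qed.
Let H1 x : H (one, x) = x. Proof. by case: H_homotopy. Qed.

(** The track of x under K, from psi(phi x) to x; its class is the component at x of the natural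
    transformation. *)
Definition K_path (x : S) : vpath R p :=
  VPath (comp_continuous (column_continuous (t := x) cK)
    (@val_continuous _ _)) (K_path_vertical x).

Definition H_path (z : U * F) : vpath R pt :=
  point_vpath (comp_continuous (column_continuous (t := z) cH)
    (@snd_continuous _ _)).

Lemma K_path_over x : (@vert_proj R E B p @^-1` U) (vclass (K_path x)).
Proof. by rewrite /vert_proj /= vsrc_vclass /= KE; exact: (set_valP x). Qed.

Definition K_ar (x : ob ZU) : ar ZU := to_sub (K_path_over x).
Definition H_ar (z : ob GU) : ar GU := (vclass (H_path (z.2, z.1)), z.2).

(** The tracks form a continuous family over p^-1(U), which inherits local path-connectedness from E
    as an open subspace. *)
Lemma K_ar_continuous : continuous K_ar.
Proof.
have S_open : open S by apply: open_comp => // y _; exact: p_continuous.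
apply: set_type_continuous.
apply: (@vclass_family_continuous _ _ _ _ _ _ S (fun z => val (K z))) => //.
- exact: locally_path_connected_sub.
- exact: comp_continuous cK (@val_continuous _ _).
Qed.

Lemma H_ar_continuous : continuous H_ar.
Proof.
apply: pair_continuous; last exact: snd_continuous.
apply: (@vclass_family_continuous _ _ _ _ _ _ (F * U)%type
  (fun z => (H (z.1, (z.2.2, z.2.1))).2)) => //.
- exact: cst_continuous.
- apply: locally_path_connected_prod => //.
  exact: locally_path_connected_sub.
- have c : continuous (fun z : I * (F * U) => (z.1, (z.2.2, z.2.1))).
    apply: pair_continuous; first exact: fst_continuous.
    exact: comp_continuous (@snd_continuous _ _) (@swap_continuous F U).
  exact: comp_continuous (comp_continuous c cH) (@snd_continuous _ _).
Qed.

Lemma src_K_ar x : src (K_ar x) = psi_ob (phi_ob x).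
Proof.
apply: val_inj; rewrite /= vsrc_vclass /= K0.
by rewrite /psi_ob /= -surjective_pairing.
Qed.

Lemma tgt_K_ar x : tgt (K_ar x) = x.
Proof. by apply: val_inj; rewrite /= vtgt_vclass /= K1. Qed.

Lemma src_H_ar z : src (H_ar z) = phi_ob (psi_ob z).
Proof.
by rewrite /= vsrc_vclass /= H0; congr pair; apply: val_inj; rewrite phiE psiE.
Qed.

Lemma tgt_H_ar z : tgt (H_ar z) = z.
Proof. by rewrite /= vtgt_vclass /= H1; case: z. Qed.

(** Let l be a path representing a. The edges of the square (t,s) |-> K(t, l(s)) are psi phi l, l
    and the tracks of the ends of l. The square lies in one fibre because K preserves p, so
    [ph_square] is the naturality identity. *)
Lemma K_natural : natural_transformation (psi_ob \o phi_ob) idfun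
  (psi_ar \o phi_ar) idfun K_ar.
Proof.
split; [exact: K_ar_continuous|exact: src_K_ar|exact: tgt_K_ar|move=> a].
apply: val_inj; set l := corestrict (arrow_over a).
have cl : continuous l.
  exact: (corestrict_continuous (@vpath_continuous _ _ _ _ _)).
pose f := psi_path (phi_path (arrow_over a)) (phi_ar a).2.
have fE t : f t = val (K (zero, l t)).
  (* The base coordinate of phi is constant along l, so the one stored in [phi_ar a] may be read at
     time t. *)
  by rewrite /f /= -/l K0 [phi (l t)]surjective_pairing -(phi_ar2 a t).
have af : val (psi_ar (phi_ar a)) = vclass f by exact: psi_arE.
have e1 : f one = K_path (tgt a) zero by rewrite fE /l tgt_restr.
have e2 : K_path (src a) one = repr (val a) zero by rewrite /= K1.
rewrite (val_tcomp_restr e1 _ af) //; last first.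
  by rewrite src_K_ar (f1_tgt psi_functorP) (f1_tgt phi_functorP).
rewrite (val_tcomp_restr e2) ?tgt_K_ar ?vclassK//.
apply/(@vclass_eqP R E B p (p (repr (val a) zero))).
  have -> : vconcat e1 zero = f zero by exact: concat0.
  by rewrite fE KE.
pose h (z : I * I) := val (K (z.1, l z.2)).
have ch : continuous h.
  have c : continuous (fun z : I * I => (z.1, l z.2)).
    apply: pair_continuous; first exact: fst_continuous.
    exact: comp_continuous (@snd_continuous _ _) cl.
  exact: comp_continuous (comp_continuous c cK) (@val_continuous _ _).
have hA z : (p @^-1` [set p (repr (val a) zero)]) (h z).
  by rewrite /h /= KE /=; exact: vpath_vertical.
have sq := ph_square ch hA.
have E1 : vconcat e1 =
    concat (fun s => h (zero, s)) (fun t => h (t, one)) :> (I -> E).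
  congr concat; apply/funext => t; first exact: fE.
  by rewrite /h /= /l tgt_restr.
have E2 : vconcat e2 =
    concat (fun t => h (t, zero)) (fun s => h (one, s)) :> (I -> E).
  congr concat; apply/funext => t; first by rewrite /h /= /l src_restr.
  by rewrite /h /= K1.
by rewrite E1 E2.
Qed.

(** The square is now the fibre component of H(t, (u, f(s))) for an arrow with base coordinate u and
    representative f; base coordinates agree since phi and psi preserve them. *)
Lemma H_natural : natural_transformation (phi_ob \o psi_ob) idfun
  (phi_ar \o psi_ar) idfun H_ar.
Proof.
split; [exact: H_ar_continuous|exact: src_H_ar|exact: tgt_H_ar|move=> b].
have eb : tgt (phi_ar (psi_ar b)) = src (H_ar (tgt b)).
  by rewrite src_H_ar (f1_tgt phi_functorP) (f1_tgt psi_functorP).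
have bU t : U (p (psi_path (repr b.1) b.2 t)).
  by rewrite /= psiE; exact: set_valP.
have bf : (phi_ar (psi_ar b)).1 = vclass (phi_path bU) by exact: phi_arE.
have fE t : phi_path bU t = (H (zero, (b.2, repr b.1 t))).2.
  by rewrite H0 /=; congr (phi _).2; exact: val_inj.
rewrite [LHS]surjective_pairing [RHS]surjective_pairing !tcomp_prod2.
congr pair; last first.
  apply: val_inj; rewrite /= phiE.
  by apply: etrans (congr1 p (vsrc_vclass _)) _; exact: psiE.
have e1 : phi_path bU one = H_path ((tgt b).2, (tgt b).1) zero by rewrite fE.
have e2 : H_path ((src b).2, (src b).1) one = repr b.1 zero by rewrite /= H1.
rewrite (tcomp_prod1 e1 eb bf) // (tcomp_prod1 e2) ?tgt_H_ar ?vclassK//.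
apply/point_vclassP.
pose h (z : I * I) := (H (z.1, (b.2, repr b.1 z.2))).2.
have ch : continuous h.
  have cr : continuous (fun z : I * I => repr b.1 z.2).
    exact: comp_continuous (@snd_continuous _ _) (@vpath_continuous _ _ _ _ _).
  have c : continuous (fun z : I * I => (z.1, (b.2, repr b.1 z.2))).
    apply: pair_continuous; first exact: fst_continuous.
    by apply: pair_continuous cr; exact: cst_continuous.
  exact: comp_continuous (comp_continuous c cH) (@snd_continuous _ _).
have sq := ph_square ch (fun _ => Logic.I : setT _).
have E1 : vconcat e1 =
    concat (fun s => h (zero, s)) (fun t => h (t, one)) :> (I -> F).
  by congr concat; apply/funext => t; exact: fE.
have E2 : vconcat e2 =
    concat (fun t => h (t, zero)) (fun s => h (one, s)) :> (I -> F).
  by congr concat; apply/funext => t; rewrite /h /= H1.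
by rewrite E1 E2.
Qed.

Lemma phi_weak_equivalence : weak_equivalence phi_functor.
Proof.
exact: (@natural_weak_equivalence ZU GU phi_functor psi_functor K_ar H_ar
  K_natural H_natural).
Qed.

Lemma restr_weakly_equivalent :
  @weakly_equivalent_over B ZU GU
    (fun z => p (val z)) (fun a => vert_proj (val a))
    (fun z => val z.2) (fun a => val a.2).
Proof.
exists ZU, (id_functor ZU), phi_functor; split.
- exact: id_weak_equivalence.
- exact: phi_weak_equivalence.
- by move=> z; rewrite /= phiE.
- by move=> a; rewrite /= phiE.
Qed.

End Trivialisation.

(** The groupoid and functor laws belong to the conclusion, since they are needed for the 2-bundle
    condition to make sense. By [idm_continuous_locally_path_connected], they already force E to be
    locally path-connected. *)
Theorem proposition4p13 (R : realType) (B E F : topologicalType) (p : E -> B)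
    (BB : open_basis B) (BE : open_basis E) (BF : open_basis F)
    (B_locally_1connected : locally_1connected R B)
    (BB_1connected : forall U, basic_open BB U -> one_connected R U)
    (p_locally_homotopy_trivial : locally_homotopy_trivial_fibration R F p)
    (F_semilocally_1connected : semilocally_1connected R F)
    (E_locally_path_connected : locally_path_connected R E) :
  exists (HZ : is_topgroupoid (vert_groupoid R p BB BE))
         (Hq : is_functor (D := vert_groupoid R p BB BE) (E := disc B)
                 p (@vert_proj R E B p))
         (HG : is_topgroupoid (fund_groupoid R BF)),
    is_2bundle (Z := TopGroupoid HZ) (Functor Hq) (TopGroupoid HG).
Proof.
have B_lpc := locally_1connected_path_connected B_locally_1connected.
have F_lpc := semilocally_locally_path_connected F_semilocally_1connected.
have [[p_continuous _] [C [C_open C_cover C_trivial]]] :=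
  p_locally_homotopy_trivial.
have HZ : is_topgroupoid (vert_groupoid R p BB BE).
  apply: vert_groupoidP => //.
  exact: fibration_locally_loop_trivial p_locally_homotopy_trivial.
have HG : is_topgroupoid (fund_groupoid R BF).
  apply: vert_groupoidP => //; first exact: cst_continuous.
  exact: point_locally_loop_trivial.
have Hq : is_functor (D := vert_groupoid R p BB BE) (E := disc B)
    p (@vert_proj R E B p).
  split=> //=.
  - exact: comp_continuous (@vsrc_continuous R E B p BB BE) p_continuous.
  - by move=> a; rewrite /vert_proj /vtgt /vsrc vpath_end.
  - by move=> x; rewrite /vert_proj vsrc_vclass.
  - by move=> a b e e'; rewrite /vert_proj /vcomp vsrc_vclass /= concat0.
exists HZ, Hq, HG, C; split=> // U CU.
have [phi [psi [[cphi cpsi phiq psiq] [[H [hH _]] [K [hK Kq1]]]]]] :=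
  C_trivial _ CU.
have phiE e : val (phi e).1 = p (val e) by exact: (congr1 (@^~ e) phiq).
have psiE z : p (val (psi z)) = val z.1 by exact: (congr1 (@^~ z) psiq).
(* A homotopy over U has a projection independent of t; its value is read off at t = 0, where K is
   psi phi. *)
have KE t e : p (val (K (t, e))) = p (val e).
  by rewrite Kq1; case: hK => _ -> _; rewrite /= psiE phiE.
exact: (restr_weakly_equivalent HZ Hq HG p_continuous B_lpc
  E_locally_path_connected F_lpc (C_open _ CU) cphi cpsi phiE psiE hK hH KE).
Qed.
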